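(* Let $R$ be a discrete valuation ring with fraction field $K$, $\Delta$ a maximal $R$-order in a $K$-central division algebra $K\Delta$ with $\Delta/\mathrm{rad}\,\Delta\simeq M_r(D)$ for a division ring $D$, and $\Lambda\subseteq M_n(\Delta)$ a normal hereditary $R$-order in $M_n(K\Delta)$ with exactly $d$ isomorphism classes of simple modules. Then there exist $b\mid r$ and a positive integer $c$ such that $M_b(\Lambda)\simeq M_c(\Delta_d)$.
   Context: $\Lambda$ is normal if its Jacobson radical is free of rank one as a left and as a right $\Lambda$-module. $\Delta_d$ denotes the subring of $M_d(\Delta)$ of matrices with entries in $\Delta$ on and above the diagonal and entries in $\mathrm{rad}\,\Delta$ strictly below the diagonal. *)

(* Defs.v *)
From HB Require Import structures.
From mathcomp Require Import all_boot all_order all_algebra all_field.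
Set Implicit Arguments. Unset Strict Implicit. Unset Printing Implicit Defensive.
Import GRing.Theory.
Local Open Scope ring_scope.

Section RingDefs.
Variable B : pzRingType.

Definition subring_of (S : B -> Prop) :=
  [/\ S 1, (forall x y, S x -> S y -> S (x - y)) & (forall x y, S x -> S y -> S (x * y))].

Definition left_ideal (L I : B -> Prop) :=
  [/\ (forall x, I x -> L x), I 0, (forall x y, I x -> I y -> I (x - y))
    & (forall l x, L l -> I x -> I (l * x))].
Definition right_ideal (L I : B -> Prop) :=
  [/\ (forall x, I x -> L x), I 0, (forall x y, I x -> I y -> I (x - y))
    & (forall l x, L l -> I x -> I (x * l))].

Definition max_left_ideal (L I : B -> Prop) :=
  [/\ left_ideal L I, (exists x, L x /\ ~ I x)
    & (forall J, left_ideal L J -> (forall x, I x -> J x) ->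
        (exists x, L x /\ ~ J x) -> forall x, J x -> I x)].

Definition jrad (L : B -> Prop) (x : B) : Prop :=
  L x /\ forall M, max_left_ideal L M -> M x.

(* I is a finitely generated projective left L-module: a retract of L^m. *)
Definition proj_left (L I : B -> Prop) :=
  exists (m : nat) (p : ('I_m -> B) -> B) (s : B -> 'I_m -> B),
     (forall v, (forall i, L (v i)) -> I (p v))
  /\ (forall v w, (forall i, L (v i)) -> (forall i, L (w i)) ->
        p (fun i => v i + w i) = p v + p w)
  /\ (forall l v, L l -> (forall i, L (v i)) -> p (fun i => l * v i) = l * p v)
  /\ (forall x, I x -> forall i, L (s x i))
  /\ (forall x y, I x -> I y -> forall i, s (x + y) i = s x i + s y i)
  /\ (forall l x, L l -> I x -> forall i, s (l * x) i = l * s x i)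
  /\ (forall x, I x -> p (s x) = x).

Definition proj_right (L I : B -> Prop) :=
  exists (m : nat) (p : ('I_m -> B) -> B) (s : B -> 'I_m -> B),
     (forall v, (forall i, L (v i)) -> I (p v))
  /\ (forall v w, (forall i, L (v i)) -> (forall i, L (w i)) ->
        p (fun i => v i + w i) = p v + p w)
  /\ (forall l v, L l -> (forall i, L (v i)) -> p (fun i => v i * l) = p v * l)
  /\ (forall x, I x -> forall i, L (s x i))
  /\ (forall x y, I x -> I y -> forall i, s (x + y) i = s x i + s y i)
  /\ (forall l x, L l -> I x -> forall i, s (x * l) i = s x i * l)
  /\ (forall x, I x -> p (s x) = x).

Definition hereditary (L : B -> Prop) :=
  (forall I, left_ideal L I -> proj_left L I) /\
  (forall I, right_ideal L I -> proj_right L I).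

(* Normal: rad L is free of rank one as a left and as a right L-module. *)
Definition normal_order (L : B -> Prop) :=
  (exists x, jrad L x /\ (forall y, jrad L y <-> exists l, L l /\ y = l * x)
             /\ (forall l, L l -> l * x = 0 -> l = 0)) /\
  (exists x, jrad L x /\ (forall y, jrad L y <-> exists l, L l /\ y = x * l)
             /\ (forall l, L l -> x * l = 0 -> l = 0)).

Definition quot_iso (L M M' : B -> Prop) :=
  exists f : B -> B,
     (forall x, L x -> L (f x))
  /\ (forall x y, L x -> L y -> M' (f (x + y) - (f x + f y)))
  /\ (forall l x, L l -> L x -> M' (f (l * x) - l * f x))
  /\ (forall x, L x -> (M x <-> M' (f x)))
  /\ (forall y, L y -> exists x, L x /\ M' (f x - y)).

(* L has exactly d isomorphism classes of simple (left) modules; every simple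
   module is L/M for a maximal left ideal M. *)
Definition num_simple_classes (L : B -> Prop) (d : nat) :=
  exists Ms : 'I_d -> B -> Prop,
  [/\ forall i, max_left_ideal L (Ms i),
      forall i j, quot_iso L (Ms i) (Ms j) -> i = j
    & forall M, max_left_ideal L M -> exists i, quot_iso L M (Ms i)].

End RingDefs.

Definition ring_iso (B1 B2 : pzRingType) (S1 : B1 -> Prop) (S2 : B2 -> Prop) :=
  exists f : B1 -> B2,
     (forall x, S1 x -> S2 (f x))
  /\ (forall y, S2 y -> exists x, S1 x /\ f x = y)
  /\ (forall x y, S1 x -> S1 y -> f x = f y -> x = y)
  /\ f 1 = 1
  /\ (forall x y, S1 x -> S1 y -> f (x + y) = f x + f y)
  /\ (forall x y, S1 x -> S1 y -> f (x * y) = f x * f y).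

Definition mx_over (T : Type) (k : nat) (S : T -> Prop) (M : 'M[T]_k) :=
  forall i j, S (M i j).

Section OrderDefs.
Variable K : fieldType.

Definition is_DVR (R : K -> Prop) :=
  [/\ subring_of R,
      (forall x : K, exists a b, [/\ R a, R b, b != 0 & x = a / b])
    & exists pi, [/\ R pi, pi != 0, ~ R pi^-1 &
        forall x, x != 0 -> exists (u : K) (z : int), [/\ R u, R u^-1 & x = u * pi ^ z]]].

(* L is an R-order in the K-algebra B (K acting through sc): a subring that is
   a finitely generated R-submodule with K L = B. *)
Definition is_order (B : pzRingType) (sc : K -> B -> B) (R : K -> Prop) (L : B -> Prop) :=
  [/\ subring_of L,
      (forall r x, R r -> L x -> L (sc r x)),
      (exists s : seq B, (forall x, x \in s -> L x) /\
         forall x, L x -> exists c : seq K,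
           [/\ forall k, k \in c -> R k, size c = size s &
               x = \sum_(i < size s) sc c`_i s`_i])
    & (forall x, exists r, [/\ R r, r != 0 & L (sc r x)])].

Definition max_order (A : falgType K) (R : K -> Prop) (L : A -> Prop) :=
  is_order ( *:%R ) R L /\
  forall G, is_order ( *:%R ) R G -> (forall x, L x -> G x) -> forall x, G x -> L x.

Definition mx_scale (A : falgType K) (n : nat) (k : K) (M : 'M[A]_n) : 'M[A]_n :=
  map_mx ( *:%R k) M.

Definition Delta_d (A : falgType K) (Delta : A -> Prop) (d : nat) (M : 'M[A]_d) :=
  forall i j : 'I_d, ((i <= j)%N -> Delta (M i j)) /\ ((j < i)%N -> jrad Delta (M i j)).

End OrderDefs.

(* Main.v *)
Require Import Defs.
From HB Require Import structures.
From mathcomp Require Import all_boot all_order all_algebra all_field.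
From Stdlib Require Import Classical ClassicalEpsilon FunctionalExtensionality.
Set Implicit Arguments.
Unset Strict Implicit.
Unset Printing Implicit Defensive.
Import GRing.Theory.
Local Open Scope ring_scope.

(* Put G = M_n(Delta) and P = M_n(rad Delta), and let rad Lambda = x Lambda with x
   invertible.  The lattices L_i = x^i G form a descending chain of
   (Lambda, G)-bimodules with rad Lambda * L_i = L_(i+1), and each L_i is projective
   over the hereditary order Lambda.  Lifting projections of L_i / L_(i+1) through a
   dual basis of L_i shows, as G / P is simple, that this quotient is a simple
   bimodule; with Nakayama's lemma this forces P = x^e G for some e > 0.  The simple
   quotients of L_0, ..., L_(e-1) represent all simple Lambda-modules exactly once,
   so e = d, and the trace ideals of the L_i together generate Lambda, so Lambda is
   the stabiliser of the chain.  Multiplication by x makes all quotients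
   L_i / L_(i+1) isomorphic as right modules, of the same length m over Delta for
   the underlying column lattices.  With b = r / gcd(m, r) and c = m / gcd(m, r),
   b copies of such a quotient form a free module of rank c over Delta / rad Delta;
   lifting bases gives a basis of Delta^(nb) adapted to the chain, and conjugating
   by it turns M_b(Lambda) into M_c(Delta_d). *)

(** * Additive subgroups, ideals and Nakayama's lemma *)

(** [R] is not assumed complete, so idempotents of a residue ring need not lift. Lifts are
    controlled only modulo a radical, and Nakayama's lemma or the invertibility of [1 - j] repairs
    the error. No quotient module is formed: maps out of a lattice are right multiplications by
    elements of the ambient ring, and statements on [lat i / lat i.+1] are congruences. Finiteness
    comes from linear dependence alone: if any [m + 1] elements are dependent over [K], a chain of
    [R]-submodules between [p L] and [L] has at most [m] strict steps. Simplicity of [G / P] enters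
    through one recurring device: the elements that carry one lattice into another by right
    multiplication are stable under [G] on both sides, so as soon as one of them lies in [G] and
    outside [P], the element [1] is among them. The factor [b] is forced by the residue ring: the
    simple right module of [M_r(D)] is a row of length [r], so a sum of [m] simple modules is free
    only if [r] divides [m]; [r / gcd(m, r)] is the least [b] for which [r] divides [b m]. *)

Definition subgroup_of (V : zmodType) (N : V -> Prop) :=
  N 0 /\ forall x y, N x -> N y -> N (x - y).

Definition lstable (B : pzRingType) (S N : B -> Prop) :=
  forall s x, S s -> N x -> N (s * x).

Definition rstable (B : pzRingType) (S N : B -> Prop) :=
  forall s x, S s -> N x -> N (x * s).

Section Subgroups.
Variables (V : zmodType) (N : V -> Prop).
Hypothesis sN : subgroup_of N.

Lemma subgroup0 : N 0. Proof. by case: sN. Qed.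

Lemma subgroupB x y : N x -> N y -> N (x - y).
Proof. by case: sN => _; apply. Qed.

Lemma subgroupN x : N x -> N (- x).
Proof. by move=> Nx; rewrite -sub0r; apply: subgroupB => //; apply: subgroup0. Qed.

Lemma subgroupD x y : N x -> N y -> N (x + y).
Proof. by move=> Nx Ny; rewrite -[y]opprK; apply/subgroupB/subgroupN. Qed.

Lemma subgroup_sum (I : Type) (r : seq I) (Q : pred I) (F : I -> V) :
  (forall i, Q i -> N (F i)) -> N (\sum_(i <- r | Q i) F i).
Proof. by move=> NF; apply: big_ind => //; [apply: subgroup0 | apply: subgroupD]. Qed.

Lemma subgroupBl x y : N (x - y) -> N y -> N x.
Proof. by move=> Nxy Ny; rewrite -[x](subrK y); apply: subgroupD. Qed.

Lemma subgroupBr x y : N (x - y) -> N x -> N y.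
Proof. by move=> Nxy Nx; rewrite -[y](subKr x); apply: subgroupB. Qed.

End Subgroups.

Lemma subrACA (V : zmodType) (a b c d : V) : a - b - (c - d) = a - c - (b - d).
Proof. by rewrite !opprB addrACA [RHS]addrACA [- b + _]addrC. Qed.

Lemma subring_subgroup (B : pzRingType) (S : B -> Prop) :
  subring_of S -> subgroup_of S.
Proof. by case=> S1 SB _; split=> //; rewrite -(subrr 1); apply: SB. Qed.

Lemma subringX (B : pzRingType) (S : B -> Prop) x k :
  subring_of S -> S x -> S (x ^+ k).
Proof.
by case=> S1 _ SM Sx; elim: k => [|k IHk]; rewrite ?expr0 ?exprS //; apply: SM.
Qed.

Lemma mx_over_subring (B : pzRingType) (S : B -> Prop) n :
  subring_of S -> subring_of (@mx_over B n S).
Proof.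
move=> sS; have gS := subring_subgroup sS; case: (sS) => S1 SB SM; split.
- by move=> i j; rewrite mxE; case: (i == j); [|apply: subgroup0].
- by move=> x y Sx Sy i j; rewrite !mxE; apply: SB.
- by move=> x y Sx Sy i j; rewrite mxE; apply: subgroup_sum => // k _; apply: SM.
Qed.

(** Stands in for containment in the Jacobson radical. It is what Nakayama's lemma needs, and it
    passes to matrices, so the radical of a matrix ring never has to be described. *)
Definition left_quasiregular (B : pzRingType) (S J : B -> Prop) :=
  forall j, J j -> exists2 s, S s & s * (1 - j) = 1.

(** Elimination: inverting [1 - j] solves the first relation for the first [l], and substitution
    leaves relations of the same kind among the others. [V] is a module over all of [B] while [N] is
    only [S]-stable, which covers both ideals and row vectors. *)
Lemma nakayama (B : pzRingType) (V : lmodType B) (S J : B -> Prop) (N : V -> Prop) :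
  subring_of S -> (forall x, J x -> S x) -> subgroup_of J -> lstable S J ->
  left_quasiregular S J ->
  subgroup_of N -> (forall s v, S s -> N v -> N (s *: v)) ->
  forall m (l : 'I_m -> V),
  (forall k, exists2 n, N n &
     exists2 j : 'I_m -> B, (forall i, J (j i)) & l k = n + \sum_i j i *: l i) ->
  forall k, N (l k).
Proof.
move=> [S1 SB SM] JS sJ SJ qJ sN SN; elim=> [|m IHm] l lE; first by case.
have [n0 Nn0 [j0 Jj0]] := lE ord0.
rewrite big_ord_recl => l0E.
have [s Ss s1] := qJ _ (Jj0 ord0).
have {}l0E : l ord0 = s *: n0 +
    \sum_(i < m) (s * j0 (lift ord0 i)) *: l (lift ord0 i).
  rewrite -[LHS]scale1r -s1 -scalerA scalerBl scale1r {1}l0E.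
  rewrite addrCA addrAC subrr add0r scalerDr; congr (_ + _).
  by rewrite scaler_sumr; apply: eq_bigr => i _; rewrite scalerA.
have Nl (i : 'I_m) : N (l (lift ord0 i)).
  apply: (IHm (fun i => l (lift ord0 i))) => k.
  have [n Nn [j Jj]] := lE (lift ord0 k).
  rewrite big_ord_recl l0E => lkE.
  exists (n + (j ord0 * s) *: n0).
    by apply: subgroupD => //; apply: SN => //; apply: SM => //; apply: JS.
  exists (fun i => j ord0 * s * j0 (lift ord0 i) + j (lift ord0 i)).
    move=> i0; apply: subgroupD => //; apply: SJ => //.
    by apply: SM => //; apply: JS.
  rewrite lkE scalerDr scalerA scaler_sumr -!addrA; congr (_ + (_ + _)).
  by rewrite -big_split; apply: eq_bigr => i0 _; rewrite scalerA mulrA scalerDl.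
move=> k; case: (unliftP ord0 k) => [i ->|->]; first exact: Nl.
rewrite l0E; apply: subgroupD => //; first exact: SN.
apply: subgroup_sum => // i _; apply: SN => //; apply: SM => //; exact: JS.
Qed.

(** The left inverse [s] equals [1 + s * j], so it has a left inverse in its turn, which must be
    [1 - j]. *)
Lemma quasiregular_inv (B : pzRingType) (S J : B -> Prop) :
  subring_of S -> subgroup_of J -> lstable S J -> left_quasiregular S J ->
  forall j, J j -> exists2 s, S s & s * (1 - j) = 1 /\ (1 - j) * s = 1.
Proof.
move=> sS sJ SJ qJ j Jj; have [s Ss s1] := qJ j Jj.
have [|t St t1] := qJ (- (s * j)); first by apply: (subgroupN sJ); apply: SJ.
have sE : 1 - - (s * j) = s.
  by rewrite opprK -{1}s1 mulrBr mulr1 subrK.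
exists s; first by []; split; first by [].
rewrite sE in t1.
have tE : t = 1 - j.
  by rewrite -[LHS]mulr1 -{1}s1 mulrA t1 mul1r.
by rewrite -tE.
Qed.

(** * Orders over a discrete valuation ring *)

Definition uniformizer (K : fieldType) (R : K -> Prop) (p : K) :=
  [/\ R p, p != 0, ~ R p^-1 &
     forall x, x != 0 -> exists (u : K) (z : int), [/\ R u, R u^-1 & x = u * p ^ z]].

Section DVR.
Variables (K : fieldType) (R : K -> Prop) (p : K).
Hypotheses (sR : subring_of R) (pR : uniformizer R p).

Lemma uniformizer_unit_or_dvd x : x != 0 -> R x^-1 \/ R (x / p).
Proof.
case: pR => Rp p0 _ valp /valp [u [z [Ru Ru1 ->]]]; case: (sR) => _ _ RM.
case: z => [[|k]|k].
- by left; rewrite expr0z mulr1.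
- by right; rewrite -exprnP exprSr mulrA mulfK //; apply: RM => //; apply: subringX.
- by left; rewrite NegzE -exprnN invfM invrK; apply: RM => //; apply: subringX.
Qed.

Lemma uniformizer_total x : R x \/ R x^-1.
Proof.
case: (eqVneq x 0) => [->|x0].
  by left; apply: subgroup0; apply: subring_subgroup.
case: (uniformizer_unit_or_dvd x0) => [|Rxp]; [by right|left].
by case: pR => Rp p0 _ _; case: sR => _ _ RM; rewrite -(divfK p0 x); apply: RM.
Qed.

Lemma uniformizer_clear x : exists t, R (p ^+ t * x).
Proof.
case: (eqVneq x 0) => [->|x0].
  by exists 0%N; rewrite mulr0; apply: subgroup0; apply: subring_subgroup.
case: pR => Rp p0 _ valp; case: (sR) => _ _ RM.
case: (valp x x0) => u [[k|k] [Ru Ru1 ->]].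
  by exists 0%N; rewrite mul1r -exprnP; apply: RM => //; apply: subringX.
by exists k.+1; rewrite NegzE -exprnN mulrCA divff ?expf_neq0 // mulr1.
Qed.

Lemma uniformizer_1B c : R c -> R (1 - p * c)^-1.
Proof.
case: pR => Rp p0 pV1 _ Rc; case: (sR) => R1 RB RM.
case: (eqVneq (1 - p * c) 0) => [E|n0].
  by rewrite E invr0; apply: subgroup0; apply: subring_subgroup.
case: (uniformizer_unit_or_dvd n0) => // Rd; case: pV1.
have -> : p^-1 = (1 - p * c) / p + c.
  by rewrite mulrBl mul1r mulrAC divff // mul1r subrK.
by apply: subgroupD => //; apply: subring_subgroup.
Qed.

Lemma min_valuation (s : seq K) :
  has (fun x => x != 0) s ->
  exists2 y, y \in s & y != 0 /\ forall x, x \in s -> R (x / y).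
Proof.
case: (sR) => R1 _ RM; have R0 : R 0 by apply: subgroup0; apply: subring_subgroup.
elim: s => //= a s IHs; case: (boolP (has _ s)) => [hs _|hs].
  have [y ys [y0 yP]] := IHs hs.
  case: (eqVneq a 0) => [->|a0].
    exists y; first by rewrite inE ys orbT.
    by split=> // x; rewrite inE => /orP [/eqP ->|/yP //]; rewrite mul0r.
  case: (uniformizer_total (a / y)) => [Ray|Rya].
    exists y; first by rewrite inE ys orbT.
    by split=> // x; rewrite inE => /orP [/eqP ->|/yP].
  exists a; first by rewrite inE eqxx.
  split=> // x; rewrite inE => /orP [/eqP ->|/yP Rxy]; first by rewrite divff.
  have -> : x / a = x / y * (a / y)^-1 by rewrite invf_div mulrA divfK.
  exact: RM.
rewrite orbF => a0; exists a; first by rewrite inE eqxx.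
split=> // x; rewrite inE => /orP [/eqP ->|xs]; first by rewrite divff.
case: (eqVneq x 0) => [->|x0]; first by rewrite mul0r.
by case/hasP: hs; exists x.
Qed.

End DVR.

Section Order.
Variables (K : fieldType) (R : K -> Prop) (p : K) (B : pzRingType).
Variable io : {rmorphism K -> B}.
Hypotheses (sR : subring_of R) (pR : uniformizer R p).
Hypothesis ioC : forall k x, io k * x = x * io k.

(** Finite dimension over [K], for a ring that carries only the map [io]. Indexing by [nat] lets
    sequences of powers and of chosen elements be used directly. *)
Definition dependent (m : nat) := forall y : nat -> B, exists2 a : nat -> K,
  (exists2 k, (k <= m)%N & a k != 0) & \sum_(k < m.+1) io (a k) * y k = 0.

Lemma order_dependent L :
  is_order (fun k x => io k * x) R L -> exists m, dependent m.
Proof.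
case=> sL LR [s [sL1 sP]] LK; exists (size s) => y.
have span (x : B) : exists c : 'I_(size s) -> K, x = \sum_i io (c i) * s`_i.
  have [r [Rr r0 /sP [c [_ _ xE]]]] := LK x.
  exists (fun i => r^-1 * c`_i).
  rewrite -[x]mul1r -(rmorph1 io) -(mulVf r0) rmorphM -mulrA xE mulr_sumr.
  by apply: eq_bigr => i _; rewrite mulrA -rmorphM.
have [c cE] := fin_all_exists (fun k : 'I_(size s).+1 => span (y k)).
pose C := \matrix_(k, i) c k i.
have : kermx C != 0.
  by rewrite kermx_eq0 /row_free neq_ltn ltnS rank_leq_col.
case/rowV0Pn=> v /sub_kermxP vC v0.
exists (fun k => v 0 (inord k)).
  case/rV0Pn: v0 => k vk; exists k; first by rewrite -ltnS.
  by rewrite inord_val.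
transitivity (\sum_(i < size s) io ((v *m C) 0 i) * s`_i); last first.
  by rewrite vC big1 // => i _; rewrite mxE rmorph0 mul0r.
under eq_bigr => k _ do rewrite cE mulr_sumr.
rewrite exchange_big; apply: eq_bigr => i _; rewrite mxE rmorph_sum mulr_suml.
by apply: eq_bigr => k _; rewrite inord_val !mxE rmorphM mulrA.
Qed.

(** * Chain conditions between [p L] and [L] *)

Section Chain.
Variable m : nat.
Hypothesis depm : dependent m.

(** The [R]-submodules between [p L] and [L], that is, the submodules of [L / p L]. The predicate
    [L] need not be an order: it is also instantiated with a lattice [lat i]. *)
Definition sublattice (L U : B -> Prop) :=
  [/\ subgroup_of U, (forall r x, R r -> U x -> U (io r * x)), (forall x, U x -> L x)
    & (forall r x, R r -> L x -> U (io (p * r) * x))].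

(* In a relation among the [y k] with coefficients in [R], not all divisible by
   [p], the first [y k] with a unit coefficient lies in [I k.+1]. *)
Lemma no_long_chain L (I : nat -> B -> Prop) (y : nat -> B) :
  (forall k, sublattice L (I k)) -> (forall k x, I k.+1 x -> I k x) ->
  (forall k, (k <= m)%N -> I k (y k) /\ ~ I k.+1 (y k)) -> False.
Proof.
move=> subI decI Iy; have [a [k0 k0m ak0] a0] := depm y.
have R0 : R 0 by apply: subgroup0; apply: subring_subgroup.
have [z zs [z0 zP]] : exists2 z, z \in mkseq a m.+1 &
    z != 0 /\ forall x, x \in mkseq a m.+1 -> R (x / z).
  apply: (min_valuation sR pR); apply/hasP; exists (a k0) => //.
  by apply/map_f; rewrite mem_iota add0n ltnS.
pose b k := a k / z.
have Rb k : (k <= m)%N -> R (b k).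
  by move=> km; apply/zP/map_f; rewrite mem_iota add0n ltnS.
have b0 : \sum_(k < m.+1) io (b k) * y k = 0.
  transitivity (io z^-1 * \sum_(k < m.+1) io (a k) * y k); last by rewrite a0 mulr0.
  by rewrite mulr_sumr; apply: eq_bigr => k _; rewrite mulrA -rmorphM mulrC.
pose unit_at k := (k <= m)%N /\ ~ R (b k / p).
have [k [[km ukp] kmin]] :
    exists k, unit_at k /\ forall j, (j < k)%N -> R (b j / p).
  have [k1 k1P] : exists k, unit_at k.
    have [k1 k1m zE] : exists2 k, (k <= m)%N & z = a k.
      by move/mapP: zs => [k]; rewrite mem_iota add0n ltnS => /andP [_ ?] ?; exists k.
    exists k1; split=> //; rewrite /b -zE divff // mul1r.
    by case: pR.
  elim/ltn_ind: k1 k1P => k1 IH k1P.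
  case: (classic (exists2 j, (j < k1)%N & ~ R (b j / p))) => [[j jk1 jP]|nj].
    by apply: (IH j jk1); split=> //; apply: ltnW (leq_trans jk1 _); case: k1P.
  exists k1; split=> // j jk1; apply: NNPP => nR; apply: nj; by exists j.
have bk0 : b k != 0 by apply/eqP => E; apply: ukp; rewrite E mul0r.
have Rbk1 : R (b k)^-1 by case: (uniformizer_unit_or_dvd sR pR bk0).
case: (Iy k km) => _; apply.
have Ile i j x : (i <= j)%N -> I j x -> I i x.
  by move=> /subnK <-; elim: (j - i)%N => [//|d IH]; rewrite addSn => /decI /IH.
have [gI RI _ pI] := subI k.+1.
have kU : I k.+1 (io (b k) * y k).
  move: b0; rewrite (bigD1 (Ordinal (km : (k < m.+1)%N))) //=.
  move=> /eqP; rewrite addr_eq0 => /eqP ->; apply: (subgroupN gI).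
  apply: subgroup_sum => // j jk; have jm : (j <= m)%N by rewrite -ltnS.
  case: (ltngtP j k) => [jk'|jk'|jk']; last by move: jk; rewrite -val_eqE /= jk' eqxx.
    have p0 : p != 0 by case: pR.
    rewrite -(divfK p0 (b j)) mulrC; apply: pI; first exact: kmin.
    by case: (subI j) => _ _ + _; apply; case: (Iy j jm).
  by apply: RI; [exact: Rb | apply: (@Ile _ j) => //; case: (Iy j jm)].
have -> : y k = io (b k)^-1 * (io (b k) * y k).
  by rewrite mulrA -rmorphM mulVf // rmorph1 mul1r.
exact: RI.
Qed.

Lemma minimal_sublattice L (Q : (B -> Prop) -> Prop) U0 :
  (forall U, Q U -> sublattice L U) -> Q U0 ->
  exists2 U, Q U &
    forall U', Q U' -> (forall x, U' x -> U x) -> forall x, U x -> U' x.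
Proof.
move=> QL QU0; apply: NNPP => noU.
have step (U : {U | Q U}) : exists U' : {U | Q U},
    (forall x, sval U' x -> sval U x) /\ exists y, sval U y /\ ~ sval U' y.
  case: U => U QU; apply: NNPP => H; apply: noU; exists U => // U' QU' sub x Ux.
  by apply: NNPP => nU'x; apply: H; exists (exist _ U' QU'); split=> //; exists x.
pose f U := sval (constructive_indefinite_description _ (step U)).
have fP U : (forall x, sval (f U) x -> sval U x) /\
    exists y, sval U y /\ ~ sval (f U) y by rewrite /f; case: constructive_indefinite_description.
pose I k := iter k f (exist _ U0 QU0).
have yP k : exists y, sval (I k) y /\ ~ sval (I k.+1) y by case: (fP (I k)).
pose y k := sval (constructive_indefinite_description _ (yP k)).
apply: (@no_long_chain L (fun k => sval (I k)) y) => [k|k|k _].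
- by apply: QL; case: (I k).
- by case: (fP (I k)).
- by rewrite /y; case: constructive_indefinite_description.
Qed.

Lemma maximal_sublattice L (Q : (B -> Prop) -> Prop) U0 :
  (forall U, Q U -> sublattice L U) -> Q U0 ->
  exists2 U, Q U &
    forall U', Q U' -> (forall x, U x -> U' x) -> forall x, U' x -> U x.
Proof.
move=> QL QU0; apply: NNPP => noU.
have step (U : {U | Q U}) : exists U' : {U | Q U},
    (forall x, sval U x -> sval U' x) /\ exists y, sval U' y /\ ~ sval U y.
  case: U => U QU; apply: NNPP => H; apply: noU; exists U => // U' QU' sub x Ux.
  by apply: NNPP => nU'x; apply: H; exists (exist _ U' QU'); split=> //; exists x.
pose f U := sval (constructive_indefinite_description _ (step U)).
have fP U : (forall x, sval U x -> sval (f U) x) /\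
    exists y, sval (f U) y /\ ~ sval U y by rewrite /f; case: constructive_indefinite_description.
pose I k := iter k f (exist _ U0 QU0).
have yP k : exists y, sval (I k.+1) y /\ ~ sval (I k) y by case: (fP (I k)).
pose y k := sval (constructive_indefinite_description _ (yP k)).
(* The ascending chain is read backwards from [m.+1]; truncated subtraction makes it constant past
   its end. *)
apply: (@no_long_chain L (fun k => sval (I (m.+1 - k)%N)) (fun k => y (m - k)%N)).
- by move=> k; apply: QL; case: (I _).
- move=> k x; rewrite subSS; case: (leqP k m) => km.
    by rewrite subSn //; case: (fP (I (m - k)%N)) => + _; apply.
  by rewrite (eqP (ltnW km : m - k == 0)%N) (eqP (km : m.+1 - k == 0)%N).
- move=> k km; rewrite subSS subSn // /y.
  by case: constructive_indefinite_description.
Qed.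

End Chain.

Definition central_order := is_order (fun k x => io k * x) R.

(** * The Jacobson radical of an order *)

Section Jacobson.
Variable L : B -> Prop.
Hypothesis oL : central_order L.

Let sL : subring_of L. Proof. by case: oL. Qed.
Let gL : subgroup_of L := subring_subgroup sL.

Lemma order_io r : R r -> L (io r).
Proof. by case: oL => [[L1 _ _] LR _ _] Rr; rewrite -[io r]mulr1; apply: LR. Qed.

Let RR : R 1 /\ R p. Proof. by case: sR => R1 _ _; case: pR. Qed.

(* Nakayama's lemma over the local ring [R]. *)
Lemma left_ideal_pi I :
  left_ideal L I ->
  (forall x, L x -> exists i l, [/\ I i, L l & x = i + io p * l]) -> I 1.
Proof.
move=> [IL I0 IB LI] cov.
have gI : subgroup_of I by [].
have [[L1 LB LM] LR [s [sL1 sP]] _] := oL.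
have Is : forall k : 'I_(size s), I s`_k.
  apply: (@nakayama B B^o (fun b => exists2 r, R r & b = io r)
    (fun b => exists2 r, R r & b = io (p * r)) I) => //.
  - case: sR => R1 RB RM; split.
    + by exists 1; rewrite ?rmorph1.
    + by move=> _ _ [a Ra ->] [b Rb ->]; exists (a - b); rewrite ?rmorphB //; apply: RB.
    + by move=> _ _ [a Ra ->] [b Rb ->]; exists (a * b); rewrite ?rmorphM //; apply: RM.
  - move=> _ [r Rr ->]; exists (p * r) => //.
    by case: sR => _ _; apply=> //; case: RR.
  - have gR := subring_subgroup sR; split.
      by exists 0; rewrite ?mulr0 ?rmorph0 //; apply: subgroup0.
    move=> _ _ [a Ra ->] [b Rb ->]; exists (a - b); first exact: subgroupB.
    by rewrite mulrBr rmorphB.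
  - move=> _ _ [a Ra ->] [b Rb ->]; exists (a * b); first by case: sR => _ _; apply.
    by rewrite -rmorphM mulrCA.
  - move=> _ [r Rr ->]; have Rd := uniformizer_1B sR pR Rr.
    exists (io (1 - p * r)^-1); first by exists (1 - p * r)^-1.
    have n0 : 1 - p * r != 0.
      apply/eqP => /eqP; rewrite subr_eq0 => /eqP E; case: pR => _ p0 + _; apply.
      by rewrite -[p^-1]mulr1 E mulKf.
    by rewrite -(rmorph1 io) -rmorphB -rmorphM mulVf.
  - by move=> _ v [r Rr ->] Iv; apply: LI => //; apply: order_io.
  - move=> k; have [|i [l [Ii Ll ->]]] := cov s`_k; first by apply/sL1/mem_nth.
    exists i => //; have [c [cR cs ->]] := sP l Ll.
    exists (fun j => io (p * c`_j)).
      by move=> j; exists c`_j => //; apply/cR/mem_nth; rewrite cs.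
    congr (_ + _); rewrite mulr_sumr; apply: eq_bigr => j _.
    by rewrite mulrA rmorphM.
have [c [cR cs ->]] := sP 1 L1; apply: subgroup_sum => // j _.
by apply: LI => //; apply/order_io/cR/mem_nth; rewrite cs.
Qed.

(** The chain condition replaces Zorn's lemma: [I + p L] is still proper by Nakayama, and the proper
    left ideals above it are sublattices. *)
Lemma left_ideal_in_max I :
  left_ideal L I -> ~ I 1 ->
  exists2 M, max_left_ideal L M & forall x, I x -> M x.
Proof.
move=> iI nI1; have [IL I0 IB LI] := iI; have gI : subgroup_of I by [].
have [[L1 LB LM] LR _ _] := oL; have [m depm] := order_dependent oL.
pose I' x := exists i l, [/\ I i, L l & x = i + io p * l].
have L0 : L 0 by apply: subgroup0.
have I'0 : left_ideal L I'.
  split.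
  - by move=> _ [i [l [/IL Li Ll ->]]]; apply: subgroupD => //; apply: LR => //; case: RR.
  - by exists 0, 0; split=> //; rewrite mulr0 addr0.
  - move=> _ _ [i [l [Ii Ll ->]]] [j [k [Ij Lk ->]]]; exists (i - j), (l - k).
    by split; [apply: IB | apply: LB | rewrite mulrBr opprD addrACA].
  - move=> a _ La [i [l [Ii Ll ->]]]; exists (a * i), (a * l).
    by split; [apply: LI | apply: LM | rewrite mulrDr !mulrA ioC].
have nI'1 : ~ I' 1.
  move=> I'1; apply/nI1/(left_ideal_pi iI) => x Lx.
  by case: I'0 => _ _ _ LI'; move: (LI' x 1 Lx I'1); rewrite mulr1.
pose Q U := [/\ left_ideal L U, (forall x, I' x -> U x) & ~ U 1].
have QL U : Q U -> sublattice L U.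
  move=> [[UL U0 UB LU] I'U _]; split=> // [r x Rr Ux|r x Rr Lx].
    by apply: LU => //; apply: order_io.
  rewrite rmorphM -mulrA; apply: I'U; exists 0, (io r * x).
  by split; rewrite ?add0r //; apply: LR.
have [M [iM I'M nM1] maxM] :=
  maximal_sublattice depm QL (And3 I'0 (fun x => id) nI'1 : Q I').
exists M => [|x Ix]; last first.
  by apply: I'M; exists x, 0; split=> //; rewrite mulr0 addr0.
split=> // [|J iJ MJ [x [Lx nJx]] y Jy]; first by exists 1.
apply: (maxM J) => //; split=> // [y' /I'M /MJ //|J1].
by apply: nJx; rewrite -[x]mulr1; case: iJ => _ _ _; apply.
Qed.

Lemma max_ideal_proper M : max_left_ideal L M -> ~ M 1.
Proof.
move=> [[_ _ _ LM] [x [Lx nMx]] _] M1; apply: nMx.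
by rewrite -[x]mulr1; apply: LM.
Qed.

Lemma max_ideal_left M : max_left_ideal L M -> subgroup_of M /\ lstable L M.
Proof. by case=> [[_ ? ? ?] _ _]. Qed.

Lemma max_ideal_unit M y :
  max_left_ideal L M -> L y -> ~ M y -> exists2 l, L l & M (l * y - 1).
Proof.
move=> mM Ly nMy; have [gM LM] := max_ideal_left mM.
have [[ML _ _ _] [x [Lx nMx]] maxM] := mM; have [L1 LB LMul] := sL.
pose J z := exists l m, [/\ L l, M m & z = l * y + m].
have J_ideal : left_ideal L J.
  split.
  - by move=> _ [l [m [Ll /ML Lm ->]]]; apply: subgroupD => //; apply: LMul.
  - by exists 0, 0; split; rewrite ?mul0r ?addr0 //; apply: subgroup0.
  - move=> _ _ [l [m [Ll Mm ->]]] [l' [m' [Ll' Mm' ->]]]; exists (l - l'), (m - m').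
    by split; [apply: LB | apply: subgroupB | rewrite mulrBl opprD addrACA].
  - move=> a _ La [l [m [Ll Mm ->]]]; exists (a * l), (a * m).
    by split; [apply: LMul | apply: LM | rewrite mulrDr mulrA].
case: (classic (J 1)) => [[l [m [Ll Mm E]]]|nJ1].
  by exists l => //; rewrite E opprD addrA subrr sub0r; apply: subgroupN.
case: nMy; apply: (maxM J) => //.
- by move=> z Mz; exists 0, z; split; rewrite ?mul0r ?add0r //; apply: subgroup0.
- by exists 1.
- by exists 1, 0; split; rewrite ?mul1r ?addr0 //; apply: subgroup0.
Qed.

Lemma jrad_ideal : subgroup_of (jrad L) /\ lstable L (jrad L).
Proof.
have [_ _ LM] := sL; split; first split.
- by split; [apply: subgroup0 | move=> M [[]]].
- move=> x y [Lx Mx] [Ly My]; split; first exact: subgroupB.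
  move=> M mM; have [gM _] := max_ideal_left mM.
  by apply: subgroupB => //; [apply: Mx | apply: My].
- move=> s x Ls [Lx Mx]; split; first exact: LM.
  by move=> M mM; have [_ LM'] := max_ideal_left mM; apply: LM' => //; apply: Mx.
Qed.

(** If [L (1 - j)] were proper it would lie in a maximal left ideal, which contains [j] and hence
    [1]. *)
Lemma jrad_quasiregular : left_quasiregular L (jrad L).
Proof.
move=> j [Lj Mj]; have [L1 LB LM] := sL.
pose I z := exists2 l, L l & z = l * (1 - j).
have iI : left_ideal L I.
  split.
  - by move=> _ [l Ll ->]; apply: LM => //; apply: LB.
  - by exists 0; rewrite ?mul0r //; apply: subgroup0.
  - by move=> _ _ [l Ll ->] [k Lk ->]; exists (l - k); rewrite ?mulrBl //; apply: LB.
  - by move=> a _ La [l Ll ->]; exists (a * l); rewrite ?mulrA //; apply: LM.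
apply: NNPP => H; have [|M mM IM] := left_ideal_in_max iI.
  by case=> l Ll E; apply: H; exists l.
apply: (max_ideal_proper mM); have [gM _] := max_ideal_left mM.
apply: (subgroupBl gM (y := j)); last exact: Mj.
by apply: IM; exists 1; rewrite ?mul1r.
Qed.

(** If a maximal [M] missed [p], some [l p] would be [1] modulo [M], so [L = M + p L], and Nakayama
    over [R] would put [1] in [M]. *)
Lemma jrad_pi : jrad L (io p).
Proof.
have [L1 LB LM] := sL; have Lp : L (io p) by apply: order_io; case: RR.
split=> // M mM; apply: NNPP => nMp; apply: (max_ideal_proper mM).
have [gM LM'] := max_ideal_left mM; have [iM _ _] := mM.
have [l Ll Ml] := max_ideal_unit mM Lp nMp.
apply: (left_ideal_pi iM) => x Lx; exists (x - x * (l * io p)), (x * l); split.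
- rewrite -{1}[x]mulr1 -mulrBr -opprB mulrN; apply: subgroupN => //; exact: LM'.
- exact: LM.
- by rewrite ioC -mulrA subrK.
Qed.

End Jacobson.

(* The lowest coefficient of a polynomial relation satisfied by [x] is cancelled
   down to the constant term, which exhibits a two-sided inverse. *)
Lemma regular_invertible L x :
  central_order L -> (forall l, L l -> x * l = 0 -> l = 0) ->
  exists xi, x * xi = 1 /\ xi * x = 1.
Proof.
move=> oL reg; have [m depm] := order_dependent oL.
have regB y : x * y = 0 -> y = 0.
  case: oL => _ _ _ LK xy; have [r [Rr r0 Lry]] := LK y.
  have : io r * y = 0 by apply: reg => //; rewrite mulrA -ioC -mulrA xy mulr0.
  by move/(congr1 ( *%R (io r^-1))); rewrite mulr0 mulrA -rmorphM mulVf // rmorph1 mul1r.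
have [a [k0 k0m ak0] a0] := depm (fun k => x ^+ k).
move: k0m; rewrite -ltnS => k0m.
elim: m.+1 a k0 k0m ak0 a0 => // n IHn a k0 k0n ak0.
rewrite big_ord_recl /= expr0 mulr1.
pose q := \sum_(i < n) io (a i.+1) * x ^+ i.
have xq : \sum_(i < n) io (a (bump 0 i)) * x ^+ bump 0 i = x * q.
  by rewrite mulr_sumr; apply: eq_bigr => i _; rewrite mulrA -ioC -mulrA -exprS.
have qx : q * x = x * q.
  rewrite mulr_suml mulr_sumr; apply: eq_bigr => i _.
  by rewrite mulrA -ioC -!mulrA -exprSr exprS.
rewrite xq; case: (eqVneq (a 0%N) 0) => [a0|a0].
  rewrite a0 rmorph0 add0r => /regB q0; case: k0 k0n ak0 => [|k0] k0n ak0.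
    by rewrite a0 eqxx in ak0.
  exact: (IHn (fun k => a k.+1) k0).
move/eqP; rewrite addrC addr_eq0 => /eqP E; exists (- (io (a 0%N)^-1 * q)).
have a1 : io (a 0%N)^-1 * io (a 0%N) = 1 by rewrite -rmorphM mulVf // rmorph1.
by split; [rewrite mulrN mulrA -ioC -mulrA | rewrite mulNr -mulrA qx]; rewrite E mulrN opprK.
Qed.

Lemma order_clear L y : central_order L -> exists t, L (io (p ^+ t) * y).
Proof.
case=> _ LR _ LK; have [r [Rr r0 Lry]] := LK y.
have [t Rt] := uniformizer_clear sR pR r^-1.
exists t; have -> : io (p ^+ t) * y = io (p ^+ t * r^-1) * (io r * y).
  by rewrite mulrA -rmorphM divfK.
exact: LR.
Qed.

(** Finite generation of [D] makes one exponent work for all its elements. Allowing every larger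
    exponent lets finitely many maps [f] share one. *)
Lemma order_absorbs (A : zmodType) (sc : K -> A -> A) (D : A -> Prop) L (f : A -> B) :
  {morph f : x y / x + y} -> f 0 = 0 -> (forall k x, f (sc k x) = io k * f x) ->
  central_order L ->
  (exists s : seq A, forall x, D x -> exists c : seq K,
     [/\ forall k, k \in c -> R k, size c = size s &
         x = \sum_(i < size s) sc c`_i s`_i]) ->
  exists t, forall u x, (t <= u)%N -> D x -> L (io (p ^+ u) * f x).
Proof.
move=> fD f0 fZ oL [s sP]; have [sL LR _ _] := oL.
have gL := subring_subgroup sL; have [Rp p0 _ _] := pR.
have [t tP] := fin_all_exists (fun i : 'I_(size s) => order_clear (f s`_i) oL).
exists (\sum_i t i)%N => u x tu /sP [c [cR cs ->]].
rewrite (big_morph f fD f0) mulr_sumr; apply: subgroup_sum => // i _.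
rewrite fZ mulrA -rmorphM mulrC rmorphM -mulrA; apply: (LR); first by apply/cR/mem_nth; rewrite cs.
have /subnK <- : (t i <= u)%N by apply: leq_trans tu; rewrite (bigD1 i) //= leq_addr.
by rewrite exprD rmorphM -mulrA; apply: LR => //; apply: subringX.
Qed.

End Order.

(** * The chain of lattices attached to a normal hereditary order *)

Section LatticeChain.
Variables (K : fieldType) (R : K -> Prop) (p : K) (B : pzRingType).
Variables (io : {rmorphism K -> B}) (L G P : B -> Prop) (x xi : B).
Hypotheses (sR : subring_of R) (pR : uniformizer R p).
Hypothesis ioC : forall k x, io k * x = x * io k.
Hypothesis oL : central_order R io L.
Hypotheses (sG : subring_of G) (LG : forall y, L y -> G y).
Hypothesis absG : exists t, forall g, G g -> L (io (p ^+ t) * g).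
Hypotheses (PG : forall y, P y -> G y) (gP : subgroup_of P).
Hypotheses (lP : lstable G P) (rP : rstable G P) (qP : left_quasiregular G P).
Hypothesis simpleGP : forall I, subgroup_of I -> lstable G I -> rstable G I ->
  forall a, I a -> G a -> ~ P a -> exists2 y, I y & P (1 - y).
Hypothesis Pp : P (io p).
Hypotheses (xxi : x * xi = 1) (xix : xi * x = 1).
Hypothesis Jx : forall y, jrad L y <-> exists l, L l /\ y = x * l.
Hypothesis herL : forall I, left_ideal L I -> proj_left L I.
Hypothesis B1 : (1 : B) <> 0.

Let sL : subring_of L. Proof. by case: oL. Qed.
Let gL : subgroup_of L := subring_subgroup sL.
Let L1 : L 1. Proof. by case: sL. Qed.
Let LM : lstable L L. Proof. by case: sL. Qed.
Let gG : subgroup_of G := subring_subgroup sG.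
Let G1 : G 1. Proof. by case: sG. Qed.
Let GM : lstable G G. Proof. by case: sG. Qed.
Let gJ : subgroup_of (jrad L). Proof. by case: (jrad_ideal oL). Qed.
Let lJ : lstable L (jrad L). Proof. by case: (jrad_ideal oL). Qed.
Let JxL l : L l -> jrad L (x * l). Proof. by move=> Ll; apply/Jx; exists l. Qed.
Let Jxx : jrad L x. Proof. by rewrite -[x]mulr1; apply: JxL. Qed.
Let Lx : L x. Proof. by case: Jxx. Qed.
Let JM M y : max_left_ideal L M -> jrad L y -> M y. Proof. by move=> mM [_]; apply. Qed.
Let xK k : xi ^+ k * x ^+ k = 1.
Proof.
elim: k => [|k IHk]; first by rewrite !expr0 mulr1.
by rewrite exprSr exprS mulrA -(mulrA _ xi) xix mulr1.
Qed.
Let Kx k : x ^+ k * xi ^+ k = 1.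
Proof.
elim: k => [|k IHk]; first by rewrite !expr0 mulr1.
by rewrite exprSr exprS mulrA -(mulrA _ x) xxi mulr1.
Qed.

Definition lat (i : nat) (v : B) := exists2 g, G g & v = x ^+ i * g.
(** The dual [Hom_L(lat i, L)], each map being represented by its right multiplier. *)
Definition dual_lat (i : nat) (w : B) := forall v, lat i v -> L (v * w).

Lemma lat_subgroup i : subgroup_of (lat i).
Proof.
split; first by exists 0; rewrite ?mulr0 //; apply: subgroup0.
by move=> _ _ [g Gg ->] [h Gh ->]; exists (g - h); rewrite ?mulrBr //; apply: subgroupB.
Qed.

Lemma lat_rstable i : rstable G (lat i).
Proof. by move=> a _ Ga [g Gg ->]; exists (g * a); rewrite ?mulrA //; apply: GM. Qed.

Lemma lat_x i v : lat i v -> lat i.+1 (x * v).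
Proof. by case=> g Gg ->; exists g; rewrite // exprS mulrA. Qed.

Lemma latS_inv i v : lat i.+1 v -> exists2 u, lat i u & v = x * u.
Proof. by case=> g Gg ->; exists (x ^+ i * g); [exists g | rewrite exprS mulrA]. Qed.

(** [rad L = x L] is stable under [L] on the left, so [l x = x l'] with [l'] in [L], and [l] moves
    past the powers of [x] one at a time. *)
Lemma lat_lstable i : lstable L (lat i).
Proof.
elim: i => [|i IHi] l v Ll.
  case=> g Gg ->; exists (l * g); first by apply: GM => //; apply: LG.
  by rewrite !expr0 !mul1r.
case/latS_inv=> u lu ->; have /Jx [l' [Ll' E]] := lJ Ll Jxx.
by rewrite mulrA E -mulrA; apply/lat_x/IHi.
Qed.

Lemma lat_J i j v : jrad L j -> lat i v -> lat i.+1 (j * v).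
Proof.
by case/Jx=> l [Ll ->] lv; rewrite -mulrA; apply/lat_x/lat_lstable.
Qed.

Lemma lat_decr i v : lat i.+1 v -> lat i v.
Proof. by case/latS_inv=> u lu ->; apply: lat_lstable. Qed.

Lemma lat_le i j v : (i <= j)%N -> lat j v -> lat i v.
Proof.
by move=> /subnK <-; elim: (j - i)%N => [//|d IH]; rewrite addSn => /lat_decr /IH.
Qed.

Lemma lat_pow i : lat i (x ^+ i).
Proof. by exists 1; rewrite ?mulr1. Qed.

Lemma lat0 v : lat 0 v <-> G v.
Proof.
split=> [[g Gg ->]|Gv]; first by rewrite expr0 mul1r.
by exists v; rewrite // expr0 mul1r.
Qed.

Lemma lat_right_order i a : lat i (x ^+ i * a) -> G a.
Proof. by case=> g Gg /(congr1 ( *%R (xi ^+ i))); rewrite !mulrA xK !mul1r => ->. Qed.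

(** Simplicity gives [y] in [I] with [1 - y] in [P]; by quasiregularity [y] is then left invertible
    in [G]. *)
Lemma two_sided_unit I a :
  subgroup_of I -> lstable G I -> rstable G I -> I a -> G a -> ~ P a -> I 1.
Proof.
move=> gI lI rI Ia Ga nPa; have [y Iy Py] := simpleGP gI lI rI Ia Ga nPa.
have [g Gg] := qP Py; rewrite subKr => <-; exact: lI.
Qed.

Lemma not_P1 : ~ P 1.
Proof. by case/qP=> g _; rewrite subrr mulr0 => /esym. Qed.

Lemma not_G_piV : ~ G (io p^-1).
Proof.
move=> Gp; apply: not_P1; have p0 : p != 0 by case: pR.
by rewrite -(rmorph1 io) -(mulVf p0) rmorphM; apply: lP.
Qed.

(** The chain [x^k L + p L] cannot descend strictly forever, so [x^k (1 - x a) = p b] for some [k],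
    and [1 - x a] is invertible in [L]. *)
Lemma jrad_nilpotent : exists N, exists2 l, L l & x ^+ N = io p * l.
Proof.
have [m depm] := order_dependent oL; have [_ LR _ _] := oL.
pose I k y := exists a b, [/\ L a, L b & y = x ^+ k * a + io p * b].
have [k Ik] : exists k, I k.+1 (x ^+ k).
  apply: NNPP => nI.
  apply: (@no_long_chain _ _ _ _ io sR pR m depm L I (fun k => x ^+ k)).
  - move=> k; split; first split.
    + exists 0, 0; rewrite !mulr0 addr0; split=> //; exact: subgroup0.
    + move=> _ _ [a [b [La Lb ->]]] [a' [b' [La' Lb' ->]]]; exists (a - a'), (b - b').
      by split; [apply: subgroupB | apply: subgroupB | rewrite !mulrBr opprD addrACA].
    + move=> r _ Rr [a [b [La Lb ->]]]; exists (io r * a), (io r * b).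
      by split; [apply: LR | apply: LR | rewrite mulrDr !mulrA (ioC r (x ^+ k)) (ioC r (io p))].
    + move=> _ [a [b [La Lb ->]]]; apply: subgroupD => //; apply: LM => //.
        exact: subringX.
      by apply: (order_io oL); case: pR.
    + move=> r y Rr Ly; exists 0, (io r * y); split.
      * exact: subgroup0.
      * exact: LR.
      * by rewrite mulr0 add0r rmorphM mulrA.
  - move=> k _ [a [b [La Lb ->]]]; exists (x * a), b; split=> //; first exact: LM.
    by rewrite exprSr mulrA.
  - move=> k _; split; last by move=> Ik; apply: nI; exists k.
    by exists 1, 0; split; rewrite ?mulr1 ?mulr0 ?addr0 //; apply: subgroup0.
case: Ik => a [b [La Lb E]]; exists k.
have [s Ls [_ s1]] := quasiregular_inv sL gJ lJ (jrad_quasiregular sR pR ioC oL) (JxL La).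
exists (b * s); first exact: LM.
rewrite -[LHS]mulr1 -s1 !mulrA mulrBr mulr1; congr (_ * _).
by rewrite {1}E exprSr -mulrA addrC addKr.
Qed.

Lemma lat_small s : exists N, forall v, lat N v -> exists2 g, G g & v = io (p ^+ s) * g.
Proof.
have [N [l Ll E]] := jrad_nilpotent; exists (N * s)%N => _ [g Gg ->].
exists (l ^+ s * g); first by apply: GM => //; apply: LG; apply: subringX.
by rewrite exprM E exprMn_comm ?mulrA ?rmorphXn //; apply: ioC.
Qed.

(** Otherwise [xi] would lie in [G], and [x^N = p l] would give [p^-1 = l xi^N] in [G]. *)
Lemma lat_strict i : ~ lat i.+1 (x ^+ i).
Proof.
case=> g Gg /(congr1 ( *%R (xi ^+ i))).
rewrite exprSr -mulrA mulrA xK mul1r => xg.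
have Gxi : G xi by rewrite -[xi]mulr1 xg mulrA xix mul1r.
have [N [l Ll E]] := jrad_nilpotent; apply: not_G_piV.
have p0 : p != 0 by case: pR.
have -> : io p^-1 = l * xi ^+ N.
  by rewrite -[LHS]mulr1 -(Kx N) mulrA E mulrA -rmorphM mulVf // rmorph1 mul1r.
by apply: GM; [apply: LG | apply: subringX].
Qed.

(* Every [L]-linear map from a lattice to [L] is a right multiplication, so a
   splitting of the projective left ideal [p^t x^i G] is a dual basis. *)
Lemma dual_basis i : exists m (w l : 'I_m -> B),
  [/\ forall k, dual_lat i (w k), forall k, lat i (l k) & \sum_k w k * l k = 1].
Proof.
have [t tP] := absG; have [_ LR _ _] := oL; have [Rp p0 _ _] := pR.
pose I v := exists2 u, lat i u & v = io (p ^+ t) * u.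
have IL v : I v -> L v.
  by case=> u lu ->; apply/tP/lat0/(lat_le (leq0n i)).
have iI : left_ideal L I.
  split=> //.
  - by exists 0; rewrite ?mulr0 //; apply: subgroup0; apply: lat_subgroup.
  - move=> _ _ [u lu ->] [v lv ->]; exists (u - v); rewrite ?mulrBr //.
    by apply: subgroupB => //; apply: lat_subgroup.
  - move=> a _ La [u lu ->]; exists (a * u); last by rewrite !mulrA ioC.
    exact: lat_lstable.
have [m [q [s [qI [qD [qZ [sL' [sD [sZ qs]]]]]]]]] := herL iI.
have [b bP] := order_clear sR pR (xi ^+ i) oL.
pose z := p ^+ t * p ^+ b; have z0 : z != 0 by rewrite mulf_neq0 ?expf_neq0.
have Iz : I (io z).
  exists (io (p ^+ b)); last by rewrite rmorphM.
  exists (xi ^+ i * io (p ^+ b)); last by rewrite mulrA Kx mul1r.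
  by rewrite -ioC; apply: LG.
have ziz : io z^-1 * io z = 1 by rewrite -rmorphM mulVf // rmorph1.
have sE v k : I v -> s v k = v * (io z^-1 * s (io z) k).
  move=> Iv; have E : io z * s v k = v * s (io z) k.
    by rewrite -sZ ?ioC ?sZ //; apply: IL.
  by rewrite mulrA -ioC -mulrA -E mulrA ziz mul1r.
pose e (k j : 'I_m) : B := (j == k)%:R.
have Le k j : L (e k j) by rewrite /e; case: eqP => _; rewrite ?mulr1n ?mulr0n //; apply: subgroup0.
have qE v : (forall k, L (v k)) -> q v = \sum_k v k * q (e k).
  move=> Lv.
  have L0 : L 0 by apply: subgroup0.
  have q0 : q (fun=> 0) = 0.
    have := qD (fun=> 0) (fun=> 0) (fun=> L0) (fun=> L0); rewrite addr0 => E.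
    by apply: (addrI (q (fun=> 0))); rewrite -E addr0.
  have sumE (r : seq 'I_m) :
      q (fun j => \sum_(k <- r) v k * e k j) = \sum_(k <- r) v k * q (e k).
    elim: r => [|k r IHr].
      rewrite big_nil -[RHS]q0; congr q.
      by apply: functional_extensionality => j; rewrite big_nil.
    rewrite big_cons -IHr -qZ // -qD => [||j].
    - by congr q; apply: functional_extensionality => j; rewrite big_cons.
    - by move=> j; apply: LM.
    - by apply: subgroup_sum => // k' _; apply: LM.
  rewrite -sumE; congr q; apply: functional_extensionality => j.
  rewrite (bigD1 j) //= /e eqxx mulr1 big1 ?addr0 // => k kj.
  by rewrite eq_sym (negPf kj) mulr0.
have ql k : exists u, lat i u /\ q (e k) = io (p ^+ t) * u.
  by case: (qI (e k) (Le k)) => u lu ->; exists u.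
have [l lE] := fin_all_exists ql.
exists m, (fun k => io (p ^+ t) * (io z^-1 * s (io z) k)), l; split.
- move=> k v lv; rewrite mulrA -ioC -sE; last by exists v.
  by apply: sL'; exists v.
- by move=> k; case: (lE k).
- have := qs _ Iz; rewrite qE => [E|k]; last exact: sL'.
  rewrite -ziz -{2}E mulr_sumr; apply: eq_bigr => k _.
  by case: (lE k) => _ ->; rewrite !mulrA; congr (_ * _); rewrite -[RHS]ioC mulrA.
Qed.

Definition between i N := [/\ subgroup_of N, lstable L N,
  (forall v, lat i.+1 v -> N v) & (forall v, N v -> lat i v)].

(* A minimal [U] with [N + U = lat i] works: an element of [N] and [U] outside
   [lat i.+1] would be detected by a maximal left ideal and let [U] shrink. *)
Lemma complement i N : between i N -> exists2 U, between i U &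
  (forall v, lat i v -> exists2 n, N n & U (v - n)) /\
  (forall v, N v -> U v -> lat i.+1 v).
Proof.
move=> [gN lN latN Nlat]; have [m depm] := order_dependent oL.
pose Q U := between i U /\ forall v, lat i v -> exists2 n, N n & U (v - n).
have glat := lat_subgroup i.
have QL U : Q U -> sublattice R p io (lat i) U.
  move=> [[gU lU latU Ulat] _]; split=> // r v Rr Uv; have Lr := order_io oL Rr.
    exact: lU.
  apply: latU; apply: lat_J => //; rewrite mulrC rmorphM; apply: lJ => //.
  exact: (jrad_pi sR pR ioC oL).
have Q0 : Q (lat i).
  split; last by move=> v lv; exists 0; rewrite ?subr0 //; apply: subgroup0.
  by split=> //; [apply: lat_lstable | move=> v /lat_decr].
have [U [[gU lU latU Ulat] cov] minU] := minimal_sublattice sR pR depm QL Q0.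
exists U => //; split=> // y Ny Uy; apply: NNPP => nly.
have [r [w [l [wP ll wl]]]] := dual_basis i.
have Lyw k : L (y * w k) by apply: wP; apply: Nlat.
have [k nJ] : exists k, ~ jrad L (y * w k).
  apply: NNPP => nk; apply: nly.
  rewrite -[y]mulr1 -wl mulr_sumr; apply: subgroup_sum; first exact: lat_subgroup.
  move=> k _; rewrite mulrA; apply: lat_J => //.
  by apply: NNPP => nJ; apply: nk; exists k.
have [M mM nM] : exists2 M, max_left_ideal L M & ~ M (y * w k).
  apply: NNPP => nM; apply: nJ; split=> // M mM.
  by apply: NNPP => nMy; apply: nM; exists M.
have [gM lM] := max_ideal_left mM.
have [s Ls Ms] := max_ideal_unit oL mM (Lyw k) nM.
apply: nM; pose U' z := U z /\ M (z * w k).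
suff /minU QU' : Q U' by case: (QU' (fun z => @proj1 _ _) y Uy).
split; first split.
- split; first by split; [|rewrite mul0r]; apply: subgroup0.
  move=> a b [Ua Ma] [Ub Mb]; split; first exact: subgroupB.
  by rewrite mulrBl; apply: subgroupB.
- by move=> a b La [Ub Mb]; split; [apply: lU | rewrite -mulrA; apply: lM].
- move=> v lv; split; first exact: latU.
  have [u lu ->] := latS_inv lv; rewrite -mulrA; apply: JM => //.
  by apply: JxL; apply: wP.
- by move=> v [/Ulat].
- move=> v /cov [n Nn Uvn]; set u := v - n in Uvn.
  have Lu : L (u * w k) by apply: wP; apply: Ulat.
  have Lm : L (u * w k * s) by apply: LM.
  exists (n + u * w k * s * y); first by apply: subgroupD => //; apply: lN.
  rewrite opprD addrA -/u; split; first by apply: subgroupB => //; apply: lU.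
  rewrite mulrBl -[X in X - _]mulr1 -!mulrA [w k * (s * _)]mulrA.
  rewrite (_ : _ - _ = - (u * w k * (s * (y * w k) - 1))).
    by apply: subgroupN => //; apply: lM.
  by rewrite mulrBr opprB !mulrA !mulr1.
Qed.

(* The projection of [lat i] onto [N] along [U], lifted through the dual basis. *)
Lemma projection i N U : between i N -> between i U ->
  (forall v, lat i v -> exists2 n, N n & U (v - n)) ->
  exists2 a, G a & forall v, lat i v -> N (v * a) /\ U (v - v * a).
Proof.
move=> [gN lN _ Nlat] [gU lU _ _] cov.
have [m [w [l [wP ll wl]]]] := dual_basis i.
have lcov k : exists n, N n /\ U (l k - n) by have [n] := cov _ (ll k); exists n.
have [n nP] := fin_all_exists lcov.
pose a := \sum_k w k * n k.
have aP v : lat i v -> N (v * a) /\ U (v - v * a).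
  move=> lv; split.
    rewrite mulr_sumr; apply: subgroup_sum => // k _; rewrite mulrA.
    by apply: lN; [apply: wP | case: (nP k)].
  rewrite -{1}[v]mulr1 -wl -mulrBr -sumrB mulr_sumr.
  apply: subgroup_sum => // k _; rewrite -mulrBr mulrA.
  by apply: lU; [apply: wP | case: (nP k)].
exists a => //; apply: (@lat_right_order i); apply: Nlat.
by case: (aP _ (lat_pow i)).
Qed.

(** A left inverse [g] of [1 - a] writes [v] as [(v g) (1 - a)], so the complementary part [U] is
    everything. *)
Lemma projection_in_P i (U : B -> Prop) a :
  P a -> (forall v, lat i v -> U (v - v * a)) -> forall v, lat i v -> U v.
Proof.
move=> Pa aU v lv; have [g Gg g1] := qP Pa.
have -> : v = v * g - v * g * a by rewrite -{1}[v]mulr1 -g1 mulrA mulrBr mulr1.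
by apply: aU; apply: lat_rstable.
Qed.

(** The [g] with [lat i * g] inside [N] are stable under [G] on both sides and include the
    projection [a] onto [N]. If [a] were in [P], the complement would be all of [lat i] and [N]
    would vanish modulo [lat i.+1]. So [1] is such a [g]. *)
Lemma lat_simple i N : between i N -> rstable G N ->
  ~ (forall v, N v -> lat i.+1 v) -> forall v, lat i v -> N v.
Proof.
move=> bN rN nN v lv; have [U bU [cov capU]] := complement bN.
have [a Ga aP] := projection bN bU cov; have [gN _ _ Nlat] := bN.
case: (classic (P a)) => [Pa|nPa].
  case: nN => u Nu; apply: capU => //.
  by apply: (projection_in_P Pa) (Nlat _ Nu) => z /aP [].
pose I g := forall v, lat i v -> N (v * g).
suff I1 : I 1 by rewrite -[v]mulr1; apply: I1.
apply: (two_sided_unit _ _ _ _ Ga nPa).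
- split=> [u _|g h Ig Ih u lu]; first by rewrite mulr0; apply: subgroup0.
  by rewrite mulrBr; apply: subgroupB => //; [apply: Ig | apply: Ih].
- by move=> g h Gg Ih u lu; rewrite mulrA; apply/Ih/lat_rstable.
- by move=> g h Gg Ih u lu; rewrite mulrA; apply/rN/Ih.
- by move=> u /aP [].
Qed.

Lemma lat_nakayama i N : subgroup_of N -> lstable L N ->
  (forall v, lat i v -> exists2 n, N n & lat i.+1 (v - n)) ->
  forall v, lat i v -> N v.
Proof.
move=> gN lN cov v lv; have [m [w [l [wP ll wl]]]] := dual_basis i.
have expand u : u = \sum_k u * w k * l k.
  by rewrite -[LHS]mulr1 -wl mulr_sumr; apply: eq_bigr => k _; rewrite mulrA.
have Nl : forall k, N (l k).
  apply: (@nakayama B B^o L (jrad L) N) => //.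
  - by move=> j [].
  - exact: (jrad_quasiregular sR pR ioC oL).
  move=> k; have [n Nn /latS_inv [u lu E]] := cov _ (ll k).
  exists n => //; exists (fun k => x * (u * w k)); first by move=> j; apply/JxL/wP.
  rewrite -[LHS](subrK n) addrC E {1}[u]expand mulr_sumr; congr (_ + _).
  by apply: eq_bigr => j _; rewrite !mulrA.
rewrite [v]expand; apply: subgroup_sum => // k _; apply: lN => //; exact: wP.
Qed.

Let LP : lstable L P. Proof. by move=> l q Ll; apply/lP/LG. Qed.

Let addP i q := exists2 a, P a & lat i (q - a).

Lemma between_addP i : (forall q, P q -> lat i q) ->
  between i (addP i.+1) /\ rstable G (addP i.+1).
Proof.
move=> Pi; have gl := lat_subgroup i.+1; split; last first.
  move=> g v Gg [a Pa la]; exists (a * g); first exact: rP.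
  by rewrite -mulrBl; apply: lat_rstable.
split.
- split; first by exists 0; [exact: (subgroup0 gP) | rewrite subrr; exact: (subgroup0 gl)].
  move=> u v [a Pa la] [b Pb lb]; exists (a - b); first exact: subgroupB.
  by rewrite subrACA; apply: subgroupB.
- move=> l v Ll [a Pa la]; exists (l * a); first exact: LP.
  by rewrite -mulrBr; apply: lat_lstable.
- by move=> v lv; exists 0; rewrite ?subr0 //; apply: subgroup0.
- move=> v [a Pa la]; apply: (subgroupBl (lat_subgroup i)) (Pi _ Pa).
  exact: lat_decr.
Qed.

(** By simplicity [P + lat 1] is [lat 1] or [lat 0]; in the second case Nakayama would give
    [P = G]. *)
Lemma P_sub_lat1 q : P q -> lat 1 q.
Proof.
have P0 a : P a -> lat 0 a by move/PG => Ga; apply/lat0.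
have [bN rN] := between_addP P0.
case: (classic (forall v, addP 1 v -> lat 1 v)) => [N1 Pq|nN].
  apply: N1; exists q => //; by rewrite subrr; apply: (subgroup0 (lat_subgroup _)).
case: not_P1; apply: (@lat_nakayama 0); last exact/lat0.
- exact: gP.
- exact: LP.
- by move=> v /(lat_simple bN rN nN).
Qed.

(** Take the last [lat e] that contains [P]: simplicity gives [P + lat e.+1 = lat e], and Nakayama
    removes the second summand. *)
Lemma radical_is_lat : exists2 e, (0 < e)%N & forall v, P v <-> lat e v.
Proof.
have [e e0 [Pe nPe]] : exists2 e, (0 < e)%N &
    (forall v, P v -> lat e v) /\ ~ (forall v, P v -> lat e.+1 v).
  apply: NNPP => ne; have Pall k v : P v -> lat k.+1 v.
    elim: k v => [|k IHk]; first exact: P_sub_lat1.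
    by apply: NNPP => nk; apply: ne; exists k.+1.
  (* The exponent 2 beats the single factor in [io p]: from [p = p^2 g] follows that [g = p^-1] lies
     in [G]. *)
  have [N NP] := lat_small 2; apply: not_G_piV.
  have [g Gg E] := NP _ (lat_decr (Pall N _ Pp)).
  have p0 : p != 0 by case: pR.
  suff -> : io p^-1 = g by [].
  rewrite -[g]mul1r -(rmorph1 io) -(mulVf (expf_neq0 2 p0)) rmorphM -mulrA -E.
  by rewrite -rmorphM expr2 invfM -mulrA mulVf // mulr1.
exists e => // v; split; first exact: Pe.
have [bN rN] := between_addP Pe.
have nN : ~ (forall v, addP e.+1 v -> lat e.+1 v).
  move=> N1; apply: nPe => u Pu; apply: N1; exists u => //.
  by rewrite subrr; apply: (subgroup0 (lat_subgroup _)).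
by apply: lat_nakayama => // u /(lat_simple bN rN nN).
Qed.

(* Von Neumann regularity of the semisimple bimodule [lat i / lat i.+1]. *)
Lemma lat_regular i y : lat i y ->
  exists2 w, dual_lat i w & lat i.+1 (y - y * w * y).
Proof.
move=> ly; have gl := lat_subgroup i.+1; have gl' := lat_subgroup i.
pose N v := exists2 l, L l & lat i.+1 (v - l * y).
have bN : between i N.
  split.
  - split; first by exists 0; [exact: (subgroup0 gL) | rewrite mul0r subr0; exact: (subgroup0 gl)].
    move=> u v [a La la] [b Lb lb]; exists (a - b); first exact: subgroupB.
    by rewrite mulrBl subrACA; apply: subgroupB.
  - move=> l v Ll [a La la]; exists (l * a); first exact: LM.
    by rewrite -mulrA -mulrBr; apply: lat_lstable.
  - by move=> v lv; exists 0; rewrite ?mul0r ?subr0 //; apply: subgroup0.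
  - move=> v [a La la]; apply: (subgroupBl gl' (y := a * y)); first exact: lat_decr.
    exact: lat_lstable.
have [U bU [cov capU]] := complement bN.
have [gU lU _ _] := bU; have [gN lN _ _] := bN.
have [m [w [l [wP ll wl]]]] := dual_basis i.
have lcov k : exists n, U (l k - n) /\ exists mu, L mu /\ lat i.+1 (n - mu * y).
  have [n [mu Lmu lmu] Un] := cov _ (ll k).
  by exists n; split=> //; exists mu.
have [n nP] := fin_all_exists lcov.
have [mu muP] := fin_all_exists (fun k => proj2 (nP k)).
(* [mu k * y] represents the component of [l k] in [N]. So right multiplication by this sum times
   [y] is, modulo [lat i.+1], the projection onto [N], which fixes [y]. *)
exists (\sum_k w k * mu k).
  move=> v lv; rewrite mulr_sumr; apply: subgroup_sum => // k _; rewrite mulrA.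
  by apply: LM; [apply: wP | case: (muP k)].
pose a := \sum_k w k * n k.
apply: (subgroupBl gl (y := y * a - y * (\sum_k w k * mu k) * y)).
  rewrite opprB addrA subrK; apply: capU.
    apply: subgroupB => //; first by exists 1; rewrite ?mul1r ?subrr //; apply: subgroup0.
    rewrite mulr_sumr; apply: subgroup_sum => // k _; rewrite mulrA.
    by apply: lN; [apply: wP | exists (mu k); case: (muP k)].
  rewrite -{1}[y]mulr1 -wl -mulrBr -sumrB mulr_sumr.
  apply: subgroup_sum => // k _; rewrite -mulrBr mulrA.
  by apply: lU; [apply: wP | case: (nP k)].
rewrite -mulrA -mulrBr mulr_suml -sumrB mulr_sumr; apply: subgroup_sum => // k _.
rewrite -mulrA -mulrBr mulrA; apply: lat_lstable; first exact: wP.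
by case: (muP k).
Qed.

(* Equivalently, the simple module [L / M] is a quotient of [lat i]. *)
Definition meets i (M : B -> Prop) :=
  exists v w, [/\ lat i v, dual_lat i w & ~ M (v * w)].

Lemma dual_lat_mul i w l : dual_lat i w -> L l -> dual_lat i (w * l).
Proof. by move=> dw Ll v lv; rewrite mulrA; apply: LM => //; apply: dw. Qed.

Lemma latS_dual_J i v w : lat i.+1 v -> dual_lat i w -> jrad L (v * w).
Proof. by case/latS_inv=> u lu -> dw; rewrite -mulrA; apply/JxL/dw. Qed.

(** Take the last [i] for which [lat i] meets [L] outside [M]; it exists because small lattices lie
    in [p L], hence in [M]. For such a [v], regularity makes [v w v] congruent to [v], so the
    functional [w * v] does not send [v] into [M]. *)
Lemma meets_exists M : max_left_ideal L M -> exists i, meets i M.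
Proof.
move=> mM; have [gM lM] := max_ideal_left mM.
have [i [v [lv Lv nMv]] Mi] : exists2 i, (exists v, [/\ lat i v, L v & ~ M v]) &
    forall v, lat i.+1 v -> L v -> M v.
  apply: NNPP => ni; have all_i k : exists v, [/\ lat k v, L v & ~ M v].
    elim: k => [|k IHk].
      by exists 1; split; [apply/lat0 | | apply: (max_ideal_proper mM)].
    apply: NNPP => nk; apply: ni; exists k => // v lv Lv; apply: NNPP => nMv.
    by apply: nk; exists v.
  have [t tP] := absG; have [N NP] := lat_small t.+1.
  have [v [lv Lv nMv]] := all_i N; have [g Gg vE] := NP v lv; apply: nMv.
  rewrite vE exprSr rmorphM -mulrA (ioC p g) mulrA.
  apply: lM; first exact: tP.
  by apply: JM => //; apply: (jrad_pi sR pR ioC oL).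
have [w dw lw] := lat_regular lv; exists i, v, (w * v); split=> //.
  exact: dual_lat_mul.
move=> Mvwv; apply: nMv; apply: (subgroupBl gM (y := v * w * v)).
  by apply: Mi => //; apply: subgroupB => //; apply: LM => //; apply: dw.
by rewrite -mulrA.
Qed.

Lemma meets_lift i M :
  max_left_ideal L M -> meets i M ->
  exists z w, [/\ lat i z, dual_lat i w & M (z * w - 1)].
Proof.
move=> mM [v [w [lv dw nM]]]; have [l Ll Ml] := max_ideal_unit oL mM (dw _ lv) nM.
by exists (l * v), w; rewrite -mulrA; split=> //; apply: lat_lstable.
Qed.

(* Any two simple quotients of [lat i] are isomorphic: a projection onto a
   complement of the first kernel is nonzero modulo [P], so by simplicity of
   [G / P] some right translate of it is nonzero on the second quotient. *)
Lemma meets_quot_iso i M M' :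
  max_left_ideal L M -> max_left_ideal L M' -> meets i M -> meets i M' ->
  quot_iso L M M'.
Proof.
move=> mM mM' mi mi'; have [gM lM] := max_ideal_left mM.
have [gM' lM'] := max_ideal_left mM'.
have [z [w [lz dw Mzw]]] := meets_lift mM mi.
have [z' [w' [lz' dw' Mzw']]] := meets_lift mM' mi'.
have gl := lat_subgroup i.
pose U v := lat i v /\ M (v * w).
have bU : between i U.
  split.
  - split; first by split; [exact: (subgroup0 gl) | rewrite mul0r; exact: (subgroup0 gM)].
    move=> a b [la Ma] [lb Mb]; split; first exact: subgroupB.
    by rewrite mulrBl; apply: subgroupB.
  - move=> l v Ll [lv Mv]; split; first exact: lat_lstable.
    by rewrite -mulrA; apply: lM.
  - by move=> v lv; split; [apply: lat_decr | apply: (JM mM); apply: (latS_dual_J lv dw)].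
  - by move=> v [].
have [V bV [cov capV]] := complement bU.
have covV v : lat i v -> exists2 n, V n & U (v - n).
  by move=> /cov [n Un Vn]; exists (v - n); rewrite ?subKr.
have [a Ga aP] := projection bV bU covV.
have UaS v : U v -> lat i.+1 (v * a).
  move=> Uv; have [Va Ua] := aP v (proj1 Uv); apply: capV => //.
  by case: bU => gU _ _ _; apply: (subgroupBr gU Ua).
have nPa : ~ P a.
  move=> Pa; have [_ Mz] : U z by apply: (projection_in_P Pa) lz => v /aP [].
  by apply: (max_ideal_proper mM); apply: (subgroupBr gM Mzw).
have [g Gg [v1 lv1 nMv1]] : exists2 g, G g & exists2 v, lat i v & ~ M' (v * a * g * w').
  apply: NNPP => ng.
  pose I h := forall g v, G g -> lat i v -> M' (v * h * g * w').
  suff I1 : I 1.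
    apply: (max_ideal_proper mM'); apply: (subgroupBr gM' Mzw').
    by have := I1 1 z' G1 lz'; rewrite !mulr1.
  apply: (two_sided_unit _ _ _ _ Ga nPa).
  - split=> [g v _ _|h k Ih Ik g v Gg lv].
      by rewrite mulr0 !mul0r; apply: (subgroup0 gM').
    by rewrite mulrBr !mulrBl; apply: subgroupB => //; [apply: Ih | apply: Ik].
  - by move=> s h Gs Ih g v Gg lv; rewrite mulrA; apply: Ih => //; apply: lat_rstable.
  - by move=> s h Gs Ih g v Gg lv; rewrite mulrA -[_ * s * g]mulrA; apply: Ih => //; apply: GM.
  - move=> g v Gg lv; apply: NNPP => nM; apply: ng; exists g => //; by exists v.
pose c := z * a * g * w'.
have UagM v : U v -> M' (v * a * g * w').
  move=> Uv; apply: JM => //; apply: (@latS_dual_J i) => //.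
  by apply: lat_rstable => //; apply: UaS.
have Lc : L c.
  by apply: dw'; do 2![apply: lat_rstable => //].
have MUz m : M m -> U (m * z).
  case: (mM) => [[ML _ _ _] _ _] Mm; split; first by apply: lat_lstable => //; apply: ML.
  rewrite -mulrA -[z * w](subrK 1) mulrDr mulr1; apply: subgroupD => //.
  by apply: lM => //; apply: ML.
have Mc m : M m -> M' (m * c).
  by move=> Mm; rewrite /c !mulrA; apply: UagM; apply: MUz.
have nMc : ~ M' c.
  move=> M'c; apply: nMv1.
  have -> : v1 * a * g * w' = v1 * w * c + (v1 - v1 * w * z) * a * g * w'.
    by rewrite /c !mulrBl !mulrA addrC subrK.
  apply: subgroupD => //; first by apply: lM' => //; apply: dw.
  have Lvw : L (v1 * w) by apply: dw.
  apply: UagM; split; first by apply: subgroupB => //; apply: lat_lstable.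
  have -> : (v1 - v1 * w * z) * w = - (v1 * w * (z * w - 1)).
    by rewrite mulrBl mulrBr opprB mulr1 !mulrA.
  by apply: subgroupN => //; apply: lM.
have [s Ls Ms] := max_ideal_unit oL mM' Lc nMc.
exists (fun l => l * c); split; [|split; [|split; [|split]]].
- by move=> l Ll; apply: LM.
- by move=> l k _ _; rewrite mulrDl subrr; apply: (subgroup0 gM').
- by move=> l k _ _; rewrite mulrA subrr; apply: (subgroup0 gM').
- move=> l Ll; split; first exact: Mc.
  move=> M'lc; apply: NNPP => nMl; have [t Lt Mt] := max_ideal_unit oL mM Ll nMl.
  apply: nMc; apply: (subgroupBr gM' (x := t * (l * c))); last exact: lM'.
  by rewrite mulrA -[X in _ - X]mul1r -mulrBl; apply: Mc.
- move=> y Ly; exists (y * s); split; first exact: LM.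
  by rewrite -[y in _ - y]mulr1 -mulrA -mulrBr; apply: lM'.
Qed.

(** Modulo [M'] the isomorphism is right multiplication by [f 1], which is composed with the
    functional [w]. *)
Lemma meets_transport i M M' :
  max_left_ideal L M' -> quot_iso L M M' -> meets i M -> meets i M'.
Proof.
move=> mM' [f [fL [_ [fZ [fM _]]]]] [v [w [lv dw nM]]].
have [gM' _] := max_ideal_left mM'; have Lvw : L (v * w) by apply: dw.
exists v, (w * f 1); split=> //; first by apply: dual_lat_mul => //; apply: fL.
rewrite mulrA => M'vw; apply: nM; apply/fM => //.
by apply: (subgroupBl gM') M'vw; rewrite -{1}[v * w]mulr1; apply: fZ.
Qed.

(** Otherwise every [x^i w k] would lie in [rad L], and the dual basis expansion of [x^i] would
    place it in [lat i.+1]. *)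
Lemma meets_surj i : exists2 M, max_left_ideal L M & meets i M.
Proof.
apply: NNPP => nM; apply: (@lat_strict i).
have [m [w [l [wP ll wl]]]] := dual_basis i.
rewrite -[x ^+ i]mulr1 -wl mulr_sumr; apply: subgroup_sum; first exact: lat_subgroup.
move=> k _; rewrite mulrA; apply: lat_J => //; have lx := lat_pow i.
split=> [|M mM]; first exact: wP.
by apply: NNPP => nMw; apply: nM; exists M => //; exists (x ^+ i), (w k).
Qed.

(** * Periodicity of the chain and the count of simple modules *)

Section Period.
Variable e : nat.
Hypotheses (e0 : (0 < e)%N) (Pe : forall v, P v <-> lat e v).

Lemma lat_addn i v : lat (i + e) v <-> exists2 q, P q & v = x ^+ i * q.
Proof.
split=> [[g Gg ->]|[q /Pe [g Gg ->] ->]].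
  by exists (x ^+ e * g); [apply/Pe; exists g | rewrite exprD mulrA].
by exists g; rewrite // exprD mulrA.
Qed.

Lemma meets_subn i M : meets (i + e) M -> meets i M.
Proof.
case=> _ [w [/lat_addn [q Pq ->] dw nM]]; exists (x ^+ i), (q * w).
rewrite mulrA; split=> //; first exact: lat_pow.
move=> _ [g Gg ->]; rewrite mulrA -[_ * q]mulrA; apply: dw.
by apply/lat_addn; exists (g * q) => //; apply: lP.
Qed.

Lemma meets_lt M : max_left_ideal L M -> exists i : 'I_e, meets i M.
Proof.
move=> mM; have [i] := meets_exists mM; elim/ltn_ind: i => i IHi mi.
case: (ltnP i e) => [ie|ei]; first by exists (Ordinal ie).
apply: (IHi (i - e)%N); first by rewrite ltn_subrL e0 (leq_trans e0).
by apply: meets_subn; rewrite subnK.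
Qed.

(** A common simple quotient yields [h = w z], which maps [lat i] into [lat j] but not into
    [lat j.+1]. It is outside [P], because [lat i * P] lies in [lat (i + e)], hence in [lat j.+1];
    here the bound on [j] enters. The two-sided ideal device then gives [lat i] inside [lat j],
    against strictness. *)
Lemma meets_inj i j M : max_left_ideal L M -> (i < j)%N -> (j < i + e)%N ->
  meets i M -> meets j M -> False.
Proof.
move=> mM ij je [v [w [lv dw nM]]] mj; have [gM lM] := max_ideal_left mM.
have [z [w' [lz dw' Mz]]] := meets_lift mM mj.
pose h := w * z.
have hP u : lat i u -> lat j (u * h).
  by move=> lu; rewrite mulrA; apply: lat_lstable => //; apply: dw.
have Gh : G h by apply: (@lat_right_order i); apply: (lat_le (ltnW ij)); apply/hP/lat_pow.
have nlh : ~ lat j.+1 (v * h).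
  move=> lvh; apply: nM; have Mvh := JM mM (latS_dual_J lvh dw').
  apply: (subgroupBr gM (x := v * h * w')) => //.
  by rewrite /h !mulrA -[_ * z * w']mulrA -[X in _ - X]mulr1 -mulrBr; apply: lM => //; apply: dw.
case: (classic (P h)) => [Ph|nPh].
  apply: nlh; apply: (lat_le je); case: lv => g Gg ->; rewrite -mulrA.
  by apply/lat_addn; exists (g * h) => //; apply: lP.
pose I g := forall u, lat i u -> lat j (u * g).
have gl := lat_subgroup j.
have I1 : I 1.
  apply: (two_sided_unit _ _ _ _ Gh nPh) => //.
  - split=> [u _|g k Ig Ik u lu]; first by rewrite mulr0; apply: (subgroup0 gl).
    by rewrite mulrBr; apply: subgroupB => //; [apply: Ig | apply: Ik].
  - by move=> g k Gg Ik u lu; rewrite mulrA; apply/Ik/lat_rstable.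
  - by move=> g k Gg Ik u lu; rewrite mulrA; apply/lat_rstable/Ik.
apply: (@lat_strict i); apply: (lat_le ij).
by rewrite -[x ^+ i]mulr1; apply/I1/lat_pow.
Qed.

Lemma number_of_simples d : num_simple_classes L d -> d = e.
Proof.
case=> Ms [mMs inj cov].
have [f fP] := fin_all_exists (fun k => meets_lt (mMs k)).
have f_inj : injective f.
  by move=> k k' E; apply: inj; apply: (@meets_quot_iso (f k)) => //; rewrite E.
have f_surj i : exists k, f k = i.
  have [M mM miM] := meets_surj i; have [k iso] := cov M mM; exists k.
  have mi := meets_transport (mMs k) iso miM; apply: val_inj; apply/eqP.
  have lte (a b : 'I_e) : (b < a + e)%N by apply: leq_trans (ltn_ord b) (leq_addl _ _).
  case: ltngtP => // lt; first by case: (meets_inj (mMs k) lt (lte _ _) (fP k) mi).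
  by case: (meets_inj (mMs k) lt (lte _ _) mi (fP k)).
apply/eqP; rewrite -[d]card_ord -[X in _ == X]card_ord -(card_codom f_inj).
apply/eqP/eq_card => i; rewrite !inE; have [k <-] := f_surj i; exact: codom_f.
Qed.

(** By periodicity, stabilising the first [e] lattices stabilises all of them. The [t] in [L] with
    [L' t] inside [L] form a left ideal containing every trace element [v w]; no maximal left ideal
    contains all of these, so [1] is such a [t]. *)
Lemma order_of_chain a :
  L a <-> forall i, (i < e)%N -> forall v, lat i v -> lat i (a * v).
Proof.
split=> [La i _ v|aP]; first exact: lat_lstable.
pose L' b := forall i v, lat i v -> lat i (b * v).
have L'a : L' a.
  move=> i; elim/ltn_ind: i => i IHi; case: (ltnP i e) => [|ei v]; first exact: aP.
  rewrite -(subnK ei) => /lat_addn [q Pq ->].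
  have [|g Gg E] := IHi (i - e)%N _ _ (lat_pow _); first by rewrite ltn_subrL e0 (leq_trans e0).
  by rewrite mulrA E -mulrA; apply/lat_addn; exists (g * q) => //; apply: lP.
pose T t := L t /\ forall b, L' b -> L (b * t).
have iT : left_ideal L T.
  split.
  - by move=> t [].
  - by split=> [|b _]; rewrite ?mulr0; apply: (subgroup0 gL).
  - move=> s t [Ls sP] [Lt tP]; split; first exact: subgroupB.
    by move=> b L'b; rewrite mulrBr; apply: subgroupB => //; [apply: sP | apply: tP].
  - move=> l t Ll [Lt tP]; split; first exact: LM.
    move=> b L'b; rewrite mulrA; apply: tP => i v lv; rewrite -mulrA.
    by apply/L'b/lat_lstable.
case: (classic (T 1)) => [[_ T1]|nT1]; first by rewrite -[a]mulr1; apply: T1.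
have [M mM TM] := left_ideal_in_max sR pR ioC oL iT nT1.
have [i [v [w [lv dw []]]]] := meets_exists mM; apply: TM; split; first exact: dw.
by move=> b L'b; rewrite mulrA; apply/dw/L'b.
Qed.

End Period.

Lemma chain_structure d : num_simple_classes L d ->
  [/\ (0 < d)%N, ~ lat 1 1, (forall v, P v <-> lat d v) &
      forall a, L a <-> forall i, (i < d)%N -> forall v, lat i v -> lat i (a * v)].
Proof.
move=> dL; have [e e0 Pe] := radical_is_lat.
rewrite (number_of_simples e0 Pe dL); split=> // [|a]; first exact: (@lat_strict 0).
exact: order_of_chain.
Qed.

End LatticeChain.

(** * Matrices over an order with simple residue ring *)

(** Rectangular form of [mx_over]; on square matrices the two are convertible and used
    interchangeably. *)
Definition mx_in (A : Type) (m n : nat) (Q : A -> Prop) (M : 'M[A]_(m, n)) :=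
  forall i j, Q (M i j).

Section MxIn.
Variables (A : pzRingType) (S Q : A -> Prop).
Hypotheses (sS : subring_of S) (gQ : subgroup_of Q) (lQ : lstable S Q) (rQ : rstable S Q).

Lemma mx_in_subgroup m n : subgroup_of (@mx_in A m n Q).
Proof.
split=> [i j|x y xQ yQ i j]; rewrite !mxE; first exact: (subgroup0 gQ).
by apply: subgroupB.
Qed.

Lemma mx_in_mull m n k (x : 'M_(m, n)) (y : 'M_(n, k)) :
  mx_in S x -> mx_in Q y -> mx_in Q (x *m y).
Proof. by move=> xS yQ i j; rewrite mxE; apply: subgroup_sum => // l _; apply: lQ. Qed.

Lemma mx_in_mulr m n k (x : 'M_(m, n)) (y : 'M_(n, k)) :
  mx_in Q x -> mx_in S y -> mx_in Q (x *m y).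
Proof. by move=> xS yQ i j; rewrite mxE; apply: subgroup_sum => // l _; apply: rQ. Qed.

Lemma mx_in_1 n : mx_in S (1%:M : 'M_n).
Proof.
case: sS => S1 _ _ i j; rewrite mxE; case: eqP => _ //=.
exact: (subgroup0 (subring_subgroup sS)).
Qed.

(** Nakayama on row vectors: the unit row [e_k] is [e_k (1 - a)] plus a combination of unit rows
    with coefficients in [Q]. So each [e_k] is some [u (1 - a)], and these [u] are the rows of a
    left inverse. *)
Lemma mx_quasiregular n : (forall q, Q q -> S q) -> left_quasiregular S Q ->
  left_quasiregular (@mx_in A n n S) (@mx_in A n n Q).
Proof.
move=> QS qQ a aQ; have gS := subring_subgroup sS; have [S1 SB SM] := sS.
pose N (v : 'rV[A]_n) := exists2 u : 'rV_n, mx_in S u & v = u *m (1%:M - a).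
have NP : forall k : 'I_n, N (delta_mx 0 k).
  apply: (@nakayama A 'rV[A]_n S Q N) => //.
  - split; first by exists 0; rewrite ?mul0mx // => i j; rewrite mxE; apply: (subgroup0 gS).
    move=> _ _ [u uS ->] [v vS ->]; exists (u - v); last by rewrite mulmxBl.
    by move=> i j; rewrite !mxE; apply: SB.
  - move=> s _ Ss [u uS ->]; exists (s *: u); last by rewrite scalemxAl.
    by move=> i j; rewrite mxE; apply: SM.
  - move=> k; exists (delta_mx 0 k *m (1%:M - a)).
      exists (delta_mx 0 k) => // i j; rewrite mxE ord1 eqxx /=.
      by case: eqP => _; rewrite ?mulr1n ?mulr0n //; apply: (subgroup0 gS).
    exists (fun i => a k i) => //; rewrite mulmxBr mulmx1 -rowE.
    rewrite -[LHS](subrK (row k a)); congr (_ + _).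
    by rewrite [LHS]row_sum_delta; apply: eq_bigr => i _; rewrite mxE.
have [u uP] := fin_all_exists (fun k => let: ex_intro2 v vS vE := NP k in
  ex_intro (fun v => mx_in S v /\ delta_mx 0 k = v *m (1%:M - a)) v (conj vS vE)).
exists (\matrix_i u i); first by move=> i j; rewrite mxE; case: (uP i) => + _; apply.
apply/row_matrixP => i; rewrite row_mul rowK -(proj2 (uP i)).
by rewrite rowE mulmx1.
Qed.

End MxIn.

Section Residue.
Variables (A : pzRingType) (S P : A -> Prop) (D : unitRingType) (r : nat).
Variable phi : A -> 'M[D]_r.
Hypothesis sS : subring_of S.
Hypothesis divD : forall t : D, t != 0 -> t \is a GRing.unit.
Hypothesis phiD : forall x y, S x -> S y -> phi (x + y) = phi x + phi y.
Hypothesis phiM : forall x y, S x -> S y -> phi (x * y) = phi x * phi y.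
Hypothesis phi1 : phi 1 = 1.
Hypothesis phi_surj : forall z, exists x, S x /\ phi x = z.
Hypothesis phiP : forall x, S x -> (phi x = 0 <-> P x).
Hypothesis PS : forall x, P x -> S x.

Let gS : subgroup_of S := subring_subgroup sS.
Let SM : lstable S S. Proof. by case: sS. Qed.
Let S1 : S 1. Proof. by case: sS. Qed.
Let S0 : S 0 := subgroup0 gS.

Let phi0 : phi 0 = 0.
Proof. by apply: (addrI (phi 0)); rewrite -phiD // !addr0. Qed.

Let phiB x y : S x -> S y -> phi (x - y) = phi x - phi y.
Proof.
move=> Sx Sy; apply: (addIr (phi y)); rewrite -phiD ?subrK //; exact: subgroupB.
Qed.

Let phi_sum (I : finType) (F : I -> A) :
  (forall i, S (F i)) -> phi (\sum_i F i) = \sum_i phi (F i).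
Proof.
move=> SF; suff [] : S (\sum_i F i) /\ phi (\sum_i F i) = \sum_i phi (F i) by [].
elim/big_rec2: _ => [//|i y z _ [Sz <-]].
by split; [apply: subgroupD | rewrite phiD].
Qed.

Lemma residue_subgroup : subgroup_of P.
Proof.
split=> [|x y Px Py]; first by apply/phiP.
have [Sx Sy] := (PS Px, PS Py).
apply/phiP; first exact: subgroupB.
by rewrite phiB // (proj2 (phiP Sx)) // (proj2 (phiP Sy)) // subr0.
Qed.

Lemma residue_lstable : lstable S P.
Proof.
move=> s x Ss Px; have Sx := PS Px; apply/phiP; first exact: SM.
by rewrite phiM // (proj2 (phiP Sx)) // mulr0.
Qed.

Lemma residue_rstable : rstable S P.
Proof.
move=> s x Ss Px; have Sx := PS Px; apply/phiP; first exact: SM.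
by rewrite phiM // (proj2 (phiP Sx)) // mul0r.
Qed.

Let gP := residue_subgroup.
Let lP := residue_lstable.
Let rP := residue_rstable.

Let eq_phi x y : S x -> S y -> phi x = phi y -> P (x - y).
Proof. by move=> Sx Sy E; apply/phiP; [apply: subgroupB | rewrite phiB // E subrr]. Qed.

(** Matrix units, lifted: for a nonzero entry [t] of [phi (a i j)], lifts of [t^-1 E_wu] and [E_vw]
    sandwich [a i j] to a lift of [E_ww], and the sum over [w] is [1] modulo [P]. Placing this at
    every diagonal position gives a scalar matrix in [I]. *)
Lemma matrix_ideal_unit n (I : 'M[A]_n -> Prop) (a : 'M[A]_n) :
  subgroup_of I -> lstable (@mx_in A n n S) I -> rstable (@mx_in A n n S) I ->
  I a -> mx_in S a -> ~ mx_in P a -> exists2 y, I y & mx_in P (1 - y).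
Proof.
move=> gI lI rI Ia aS naP.
have [i [j naij]] : exists i j, ~ P (a i j).
  apply: NNPP => nij; apply: naP => i j; apply: NNPP => naij; apply: nij.
  by exists i, j.
have /matrix0Pn [u [v tuv]] : phi (a i j) != 0.
  by apply/eqP => /phiP Pa; apply: naij; apply: Pa.
set t := phi (a i j) u v in tuv.
have [al alP] := fin_all_exists (fun w : 'I_r => phi_surj (t^-1 *: delta_mx w u)).
have [be beP] := fin_all_exists (fun w : 'I_r => phi_surj (delta_mx v w)).
pose s := \sum_w al w * a i j * be w.
have Ssw w : S (al w * a i j * be w).
  by case: (alP w) (beP w) => Sa _ [Sb _]; do 2!apply: SM => //.
have Ss : S s by apply: subgroup_sum.
have Ps : P (1 - s).
  apply: eq_phi => //; rewrite phi1 phi_sum //.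
  transitivity (\sum_w delta_mx w w : 'M[D]_r).
    by rewrite -[1]/(1%:M) scalar_mx_sum_delta; apply: eq_bigr => w _; rewrite scale1r.
  apply: eq_bigr => w _; have [Sa Ea] := alP w; have [Sb Eb] := beP w.
  rewrite phiM ?phiM ?Ea ?Eb //; last exact: SM.
  apply/matrixP => k l; rewrite !mxE (bigD1 v) //= big1 => [|m mv]; last first.
    by rewrite [delta_mx _ _ _ _]mxE (negPf mv) mulr0.
  rewrite !mxE eqxx addr0 (bigD1 u) //= big1 => [|m mu]; last first.
    by rewrite !mxE (negPf mu) andbF mulr0 mul0r.
  rewrite !mxE eqxx addr0 andbT -/t; case: (k == w); case: (l == w) => /=;
    by rewrite ?mulr0 ?mul0r ?mulr1 // mulVr // divD.
pose y : 'M[A]_n := \sum_(k < n) \sum_(w < r)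
  (al w *: delta_mx k i) *m a *m (be w *: delta_mx j k).
exists y.
  have Sdelta c k l : S c -> mx_in S (c *: delta_mx k l : 'M_n).
    by move=> Sc p q; rewrite !mxE; case: (_ && _); rewrite ?mulr1 ?mulr0.
  apply: subgroup_sum => // k _; apply: subgroup_sum => // w _.
  apply: rI; first by apply: Sdelta; case: (beP w).
  by apply: lI => //; apply: Sdelta; case: (alP w).
have yE : y = s%:M.
  rewrite scalar_mx_sum_delta; apply: eq_bigr => k _.
  rewrite scaler_suml; apply: eq_bigr => w _; apply/matrixP => p q.
  rewrite !mxE (bigD1 j) //= big1 => [|m mj]; last by rewrite !mxE (negPf mj) !mulr0.
  rewrite !mxE eqxx addr0 (bigD1 i) //= big1 => [|m mi]; last first.
    by rewrite !mxE (negPf mi) andbF mulr0 mul0r.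
  rewrite !mxE eqxx addr0 andbT; case: (p == k); case: (q == k) => /=;
    by rewrite ?mulr0 ?mul0r ?mulr1.
rewrite yE -[1]/(1%:M) -rmorphB /= => k l; rewrite mxE.
by case: eqP => _ //=; apply: (subgroup0 gP).
Qed.

(** * Bases of residue modules *)

Variables (E : 'I_r -> 'I_r -> A) (o : 'I_r).
Hypotheses (SE : forall u v, S (E u v)) (phiE : forall u v, phi (E u v) = delta_mx u v).

(** Lifts a rank one idempotent of [M_r(D)]; it is idempotent only modulo [P]. *)
Let e := E o o.
Let Se : S e := SE o o.

(* Column vectors [W *m (e *: t)] are combinations of the columns of [W e], each
   of which generates a simple right module modulo [P]. *)
Definition residue_spans n m (x : 'M[A]_n) (W : 'M[A]_(n, m)) :=
  forall v : 'cV_n, mx_in S v -> exists t u,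
    [/\ mx_in S t, mx_in S u & v = W *m (e *: t) + x *m u].

Definition residue_free n m (x : 'M[A]_n) (W : 'M[A]_(n, m)) :=
  forall (t : 'cV_m) (u : 'cV_n), mx_in S t -> mx_in S u ->
  W *m (e *: t) = x *m u -> mx_in P (e *: t).

Lemma scale_mxcol (a : A) k (q : 'I_k -> nat) n (C : forall i, 'M[A]_(q i, n)) :
  a *: (\mxcol_i C i) = \mxcol_i (a *: C i).
Proof. by apply/matrixP => i j; rewrite !mxE. Qed.

Lemma mx_in_mxcol (Q : A -> Prop) k (q : 'I_k -> nat) n (C : forall i, 'M[A]_(q i, n)) :
  mx_in Q (\mxcol_i C i) <-> forall i, mx_in Q (C i).
Proof.
split=> [CQ i a b|CQ i j]; last by rewrite mxE; apply: CQ.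
by rewrite -[C i](mxcolK C) mxE; apply: CQ.
Qed.

Section Lattice.
Variables (n : nat) (x : 'M[A]_n).
Hypothesis Px : forall v : 'cV_n, mx_in P v -> exists2 u, mx_in S u & v = x *m u.

(** Modulo [P], [1] is the sum of the [E u o * e * E o u], and [Px] absorbs the error into [x]. *)
Lemma residue_spans_exists : exists m (W : 'M[A]_(n, m)), mx_in S W /\ residue_spans x W.
Proof.
exists (\sum_(u < r) n)%N, (\mxrow_u (E u o)%:M); split.
  move=> i j; rewrite !mxE; case: (_ == _) => /=; rewrite ?mulr1n ?mulr0n //; exact: SE.
move=> v vS; pose s := \sum_u E u o * (e * E o u).
have Sue u : S (E u o * (e * E o u)) by do 2!apply: SM => //.
have Ss : S s by apply: subgroup_sum.
have Ps : P (1 - s).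
  apply: eq_phi => //; rewrite phi1 phi_sum // -[1]/(1%:M) scalar_mx_sum_delta.
  apply: eq_bigr => u _; rewrite !phiM //; last exact: SM.
  by rewrite !phiE -!mulmxE !mul_delta_mx scale1r.
have [|u uS uE] := Px (v := v - s *: v).
  rewrite -{1}[v]scale1r -scalerBl => i j; rewrite mxE; exact: rP.
exists (\mxcol_w (E o w *: v)), u; split=> //.
  by apply/mx_in_mxcol => w i j; rewrite mxE; apply: SM.
rewrite scale_mxcol mul_mxrow_mxcol -uE addrC -[LHS](subrK (s *: v)); congr (_ + _).
by rewrite scaler_suml; apply: eq_bigr => w _; rewrite mul_scalar_mx !scalerA !mulrA.
Qed.

(* In a spanning family of least size, a relation with a coordinate that is
   nonzero modulo [P] would express one column through the others. *)
Lemma residue_basis_exists : exists m (W : 'M[A]_(n, m)),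
  [/\ mx_in S W, residue_spans x W & residue_free x W].
Proof.
have [m0 [W0 W0P]] := residue_spans_exists.
have [m [W [WS Wsp]] minm] : exists2 m,
    exists W : 'M[A]_(n, m), mx_in S W /\ residue_spans x W &
    forall m', (m' < m)%N -> ~ exists W : 'M[A]_(n, m'), mx_in S W /\ residue_spans x W.
  elim/ltn_ind: m0 W0 W0P => m0 IH W0 W0P.
  case: (classic (exists2 m', (m' < m0)%N &
      exists W : 'M[A]_(n, m'), mx_in S W /\ residue_spans x W)) => [[m' lt [W WP]]|nm].
    exact: (IH m' lt W WP).
  by exists m0; [exists W0 | move=> m' lt ex; apply: nm; exists m'].
exists m, W; split=> // t u tS uS tu; apply: NNPP => nP.
have [k nPk] : exists k, ~ P (e * t k 0).
  apply: NNPP => nk; apply: nP => k j; rewrite ord1 mxE; apply: NNPP => nPk.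
  by apply: nk; exists k.
case: m W WS Wsp minm t tS tu nP k nPk => [|m] W WS Wsp minm t tS tu nP k nPk.
  by case: k nPk.
have Sk : S (t k 0) by apply: tS.
(* Row [o] of [phi (t k 0)] has a nonzero entry; its inverse, moved into column [o], lifts to
   [c]. *)
have [c Sc cP] : exists2 c, S c & P (e - e * (t k 0 * c)).
  have : phi (e * t k 0) != 0.
    by apply/eqP => /phiP Pe; apply: nPk; apply: Pe; apply: SM.
  rewrite phiM // phiE => /matrix0Pn [i [j]]; rewrite mxE (bigD1 o) //= big1; last first.
    by move=> l lo; rewrite mxE (negPf lo) andbF mul0r.
  rewrite mxE eqxx andbT addr0; case: (i =P o) => [_|_]; last by rewrite mul0r eqxx.
  rewrite mul1r => tau0; have [c [Sc cE]] := phi_surj ((phi (t k 0) o j)^-1 *: delta_mx j o).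
  exists c => //; have Stc : S (t k 0 * c) by apply: SM.
  apply: eq_phi => //; first exact: SM.
  rewrite !phiM // phiE cE; apply/matrixP => a b; rewrite !mxE (bigD1 o) //= big1.
    rewrite !mxE eqxx andbT addr0 (bigD1 j) //= big1.
      rewrite !mxE eqxx addr0; case: (a == o) => /=; last by rewrite mul0r.
      rewrite mul1r; case: (b == o); rewrite ?mulr0 // mulr1 mulrV //; exact: divD.
    by move=> l lj; rewrite !mxE (negPf lj) !mulr0.
  by move=> l lo; rewrite mxE (negPf lo) andbF mul0r.
(* Column [k] is redundant: subtracting the relation times [c * t' k 0] brings its coefficient into
   [P], and the rest is absorbed by [x]. *)
case: (minm m (ltnSn m)); exists (col' k W); split.
  by move=> i j; rewrite mxE; apply: WS.
move=> v /Wsp [t' [u' [t'S u'S vE]]].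
pose f := c * t' k 0; have Sf : S f by apply: SM.
pose rs q (y : 'M[A]_(q, 1)) := \matrix_(i, j) (y i j * f).
have rsM q q' (M : 'M_(q', q)) (y : 'cV_q) : M *m rs _ y = rs _ (M *m y).
  by apply/matrixP => i j; rewrite !mxE mulr_suml; apply: eq_bigr => l _; rewrite !mxE mulrA.
have rsS q (y : 'M_(q, 1)) : mx_in S y -> mx_in S (rs _ y).
  by move=> yS i j; rewrite mxE; apply: SM.
pose eta := t' - rs _ t.
have etaS : mx_in S eta by apply: (subgroupB (mx_in_subgroup gS _ _)) => //; apply: rsS.
have Pk : P (e * eta k 0).
  have -> : e * eta k 0 = (e - e * (t k 0 * c)) * t' k 0.
    by rewrite !mxE /f mulrBl mulrBr !mulrA.
  exact: rP.
pose wk : 'cV[A]_n := \matrix_(i, j) (W i k * (e * eta k 0)).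
have [u2 u2S u2E] : exists2 u2, mx_in S u2 & wk = x *m u2.
  by apply: Px => i j; rewrite mxE; apply: lP.
have rstu : W *m (e *: rs _ t) = x *m rs _ u.
  rewrite rsM -tu -rsM; congr (_ *m _).
  by apply/matrixP => i j; rewrite !mxE mulrA.
exists (row' k eta), (u' + rs _ u + u2); split.
- by move=> i j; rewrite mxE; apply: etaS.
- by do 2![apply: (subgroupD (mx_in_subgroup gS _ _)) => //]; apply: rsS.
have -> : v = W *m (e *: eta) + x *m (u' + rs _ u).
  by rewrite vE scalerBr mulmxBr rstu mulmxDr addrCA subrK addrC.
rewrite [in RHS]mulmxDr [in RHS](addrC (x *m (u' + rs _ u))) [in RHS]addrA.
congr (_ + _).
rewrite -u2E; apply/matrixP => i j; rewrite ord1 !mxE (bigD1_ord k) //= addrC.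
by congr (_ + _); [apply: eq_bigr => l _|]; rewrite !mxE.
Qed.

End Lattice.

Lemma residue_copies n m b (x : 'M[A]_n) (W : 'M[A]_(n, m)) :
  mx_in S W -> residue_spans x W -> residue_free x W ->
  exists W' : 'M[A]_(\sum_(i < b) n, \sum_(i < b) m),
  [/\ mx_in S W', residue_spans (\mxdiag_(i < b) x) W' &
      residue_free (\mxdiag_(i < b) x) W'].
Proof.
move=> WS Wsp Wfree.
pose W' : 'M[A]_(\sum_(i < b) n, \sum_(i < b) m) :=
  \mxblock_(i, j) (if i == j then W else 0).
have W'E (y : 'I_b -> 'cV[A]_m) : W' *m (\mxcol_i y i) = \mxcol_i (W *m y i).
  rewrite mul_mxblock_mxrow; apply: eq_mxcol => i.
  rewrite (bigD1 i) //= eqxx big1 ?addr0 // => j ji.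
  by rewrite eq_sym (negPf ji) mul0mx.
exists W'; split.
- by move=> i j; rewrite mxE; case: eqP => _; [apply: WS | rewrite mxE].
- move=> v; rewrite -[v]submxcolK => /mx_in_mxcol vS.
  have [t tP] := fin_all_exists (fun i => Wsp _ (vS i)).
  have [u uP] := fin_all_exists tP.
  exists (\mxcol_i t i), (\mxcol_i u i); split.
  + by apply/mx_in_mxcol => i; case: (uP i).
  + by apply/mx_in_mxcol => i; case: (uP i).
  + rewrite scale_mxcol W'E mul_mxdiag_mxcol -mxcolD; apply: eq_mxcol => i.
    by case: (uP i).
- move=> t u; rewrite -[t]submxcolK -[u]submxcolK => /mx_in_mxcol tS /mx_in_mxcol uS.
  rewrite scale_mxcol W'E mul_mxdiag_mxcol => /eq_mxcolP tu.
  by apply/mx_in_mxcol => i; apply: (Wfree _ _ (tS i) (uS i)).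
Qed.

(** The free right module of rank one over [M_r(D)] is a sum of [r] simple row modules. [T] splits a
    coefficient [t j] into its rows [E o w * t j]; modulo [P], multiplying these by [E w o] and
    summing over [w] reassembles it. *)
Lemma residue_regroup N M c (X : 'M[A]_N) (W : 'M[A]_(N, M)) :
  M = (\sum_(j < c) r)%N ->
  (forall v : 'cV_N, mx_in P v -> exists2 u, mx_in S u & v = X *m u) ->
  mx_in S W -> residue_spans X W -> residue_free X W ->
  exists F : 'M[A]_(N, c),
  [/\ mx_in S F,
      forall v : 'cV_N, mx_in S v ->
        exists t u, [/\ mx_in S t, mx_in S u & v = F *m t + X *m u] &
      forall (t : 'cV_c) (u : 'cV_N), mx_in S t -> mx_in S u ->
        F *m t = X *m u -> mx_in P t].
Proof.
move=> EM PX; subst M => WS Wsp Wfree.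
pose T : 'M[A]_(\sum_(j < c) r, c) :=
  \matrix_(a, j) if tagnat.sig1 a == j then E o (tagnat.sig2 a) else 0.
have TE (t : 'cV_c) a : (T *m t) a 0 = E o (tagnat.sig2 a) * t (tagnat.sig1 a) 0.
  rewrite mxE (bigD1 (tagnat.sig1 a)) //= mxE eqxx big1 ?addr0 // => j ja.
  by rewrite mxE eq_sym (negPf ja) mul0r.
have TS : mx_in S T by move=> a j; rewrite mxE; case: eqP.
have gmS k l := mx_in_subgroup gS k l.
exists (W *m T); split; first exact: (mx_in_mull gS SM WS TS).
- move=> v /Wsp [t [u [tS uS vE]]].
  pose t' : 'cV[A]_c := \col_j \sum_w E w o * t (tagnat.Rank j w) 0.
  have t'S : mx_in S t'.
    by move=> j l; rewrite mxE; apply: subgroup_sum => // w _; apply: SM.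
  have diffP : mx_in P (e *: t - T *m t').
    move=> a l; rewrite ord1 [X in P X]mxE [X in _ + X]mxE TE mxE.
    have St a' : S (t a' 0) by apply: tS.
    apply: eq_phi; [exact: SM | by apply: SM |].
    rewrite !phiM // phiE mxE phi_sum => [|w]; last exact: SM.
    rewrite mulr_sumr (bigD1 (tagnat.sig2 a)) //= phiM // !phiE mulrA.
    rewrite -!mulmxE mul_delta_mx tagnat.sig2K.
    rewrite [X in _ = _ + X]big1 ?addr0 // => w wa.
    by rewrite phiM // phiE -mulmxE mulmxA mul_delta_mx_cond eq_sym (negPf wa) mulr0n mul0mx.
  have [u2 u2S u2E] := PX _ (mx_in_mull gP lP WS diffP).
  exists t', (u + u2); split=> //; first exact: (subgroupD (gmS _ _)).
  by rewrite vE mulmxDr -u2E mulmxBr mulmxA addrCA [X in _ = _ + X]addrC subrK addrC.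
- move=> t u tS uS tu; have TtS : mx_in S (T *m t) by apply: (mx_in_mull gS SM TS tS).
  have diffP : mx_in P (T *m t - e *: (T *m t)).
    move=> a l; rewrite ord1 mxE [X in _ + X]mxE [X in _ - X]mxE TE mulrA -mulrBl.
    apply: rP; first exact: tS.
    apply: eq_phi => //; first exact: SM.
    by rewrite phiM // !phiE -mulmxE mul_delta_mx.
  have [u2 u2S u2E] := PX _ (mx_in_mull gP lP WS diffP).
  have TtP : mx_in P (T *m t).
    rewrite -[T *m t](subrK (e *: (T *m t))).
    apply: (subgroupD (mx_in_subgroup gP _ _)) => //.
    apply: (Wfree _ (u - u2)) => //; first exact: (subgroupB (gmS _ _)).
    by rewrite mulmxBr -u2E -tu mulmxBr mulmxA subKr.
  move=> j l; rewrite ord1; have Sj : S (t j 0) by apply: tS.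
  apply/phiP => //; apply/matrixP => w z.
  have := TtP (tagnat.Rank j w) 0; rewrite TE tagnat.Rank1K.
  have -> : tagnat.sig2 (tagnat.Rank j w : 'I_(\sum_(j < c) r)) = w :> 'I_r.
    by apply: val_inj; rewrite tagnat.Rank2K.
  move/phiP; rewrite phiM // phiE => /(_ (SM (SE _ _) Sj)) /matrixP /(_ o z).
  rewrite !mxE (bigD1 w) //= mxE !eqxx mul1r big1 ?addr0 // => k kw.
  by rewrite mxE (negPf kw) andbF mul0r.
Qed.
End Residue.

(** * Conjugating a lattice chain into standard form *)

Section Flag.
Variables (A : pzRingType) (S P : A -> Prop) (N d c : nat).
Variables (X Xi : 'M[A]_N) (F : 'M[A]_(N, c)).
Hypotheses (sS : subring_of S) (PS : forall y, P y -> S y) (gP : subgroup_of P).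
Hypotheses (lP : lstable S P) (rP : rstable S P) (qP : left_quasiregular S P).
Hypotheses (XS : mx_in S X) (XiX : Xi * X = 1) (FS : mx_in S F).

Definition col_lat i (v : 'cV[A]_N) := exists2 u, mx_in S u & v = X ^+ i *m u.

Hypothesis PX : forall v, mx_in P v <-> col_lat d v.
Hypothesis Fspan : forall v : 'cV_N, mx_in S v ->
  exists t u, [/\ mx_in S t, mx_in S u & v = F *m t + X *m u].
Hypothesis Ffree : forall (t : 'cV_c) (u : 'cV_N), mx_in S t -> mx_in S u ->
  F *m t = X *m u -> mx_in P t.

Let gS : subgroup_of S := subring_subgroup sS.
Let SM : lstable S S. Proof. by case: sS. Qed.
Let gmS m n := mx_in_subgroup gS m n.
Let gmP m n := mx_in_subgroup gP m n.
Let S_mul m n k (x : 'M_(m, n)) (y : 'M_(n, k)) :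
  mx_in S x -> mx_in S y -> mx_in S (x *m y).
Proof. exact: (mx_in_mull gS SM). Qed.

Let XkS k : mx_in S (X ^+ k).
Proof. exact: (subringX k (mx_over_subring N sS) XS). Qed.

Let XkK k : Xi ^+ k *m X ^+ k = 1.
Proof.
rewrite mulmxE; elim: k => [|k IHk]; first by rewrite !expr0 mulr1.
by rewrite exprSr exprS mulrA -(mulrA _ Xi) XiX mulr1.
Qed.

Lemma col_lat_subgroup i : subgroup_of (col_lat i).
Proof.
split; first by exists 0; rewrite ?mulmx0 //; apply: (subgroup0 (gmS _ _)).
move=> _ _ [u uS ->] [v vS ->]; exists (u - v); last by rewrite mulmxBr.
exact: (subgroupB (gmS _ _)).
Qed.

Lemma col_lat_le i j v : (i <= j)%N -> col_lat j v -> col_lat i v.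
Proof.
move=> ij [u uS ->]; exists (X ^+ (j - i) *m u); first exact: S_mul.
by rewrite mulmxA mulmxE -exprD subnKC.
Qed.

Lemma col_lat_S i v : col_lat i v -> mx_in S v.
Proof. by case=> u uS ->; apply: S_mul. Qed.

(** The powers of [X] decrease along the blocks, so that the stabiliser of the chain comes out
    upper, not lower, triangular modulo [P]. *)
Definition chain_mx : 'M[A]_(N, \sum_(k < d) c) :=
  \mxrow_(k < d) (X ^+ (d.-1 - k) *m F).

Lemma chain_mxS : mx_in S chain_mx.
Proof. by move=> i a; rewrite mxE; apply: S_mul. Qed.

Lemma chain_mxE (u : 'cV[A]_(\sum_(k < d) c)) :
  chain_mx *m u = \sum_(k < d) X ^+ (d.-1 - k) *m (F *m submxcol u k).
Proof.
rewrite -{1}[u]submxcolK mul_mxrow_mxcol.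
by apply: eq_bigr => k _; rewrite mulmxA.
Qed.

(** [col_lat i] in the coordinates of [chain_mx]: the last [i] of the [d] blocks lie in [P]. *)
Definition std_flag i (u : 'cV[A]_(\sum_(k < d) c)) :=
  forall a : 'I_(\sum_(k < d) c), S (u a 0) /\ ((d <= tagnat.sig1 a + i)%N -> P (u a 0)).

Lemma std_flag_block i u (k : 'I_d) : std_flag i u ->
  mx_in S (submxcol u k) /\ ((d <= k + i)%N -> mx_in P (submxcol u k)).
Proof.
move=> fu; have Rk (j : 'I_c) : tagnat.sig1 (tagnat.Rank k j : 'I_(\sum_(k < d) c)) = k.
  exact: tagnat.Rank1K.
split=> [a b|le a b]; rewrite ord1 mxE; first by case: (fu (tagnat.Rank k a)).
by case: (fu (tagnat.Rank k a)) => _; rewrite Rk; apply.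
Qed.

Lemma col_lat_term i k (y : 'cV_c) : (i <= d)%N ->
  mx_in S y -> ((d <= k + i)%N -> mx_in P y) -> col_lat i (X ^+ (d.-1 - k) *m (F *m y)).
Proof.
move=> le_id yS yP; case: (leqP d (k + i)) => dki.
  apply: (col_lat_le le_id); apply/PX.
  by do 2!apply: (mx_in_mull gP lP) => //; apply: yP.
apply: (@col_lat_le i (d.-1 - k)); last by exists (F *m y) => //; apply: S_mul.
by rewrite leq_subRL -1?ltnS ?(ltn_predK dki) // (leq_ltn_trans _ dki) // leq_addr.
Qed.

Lemma chain_mx_flag i u : (i <= d)%N -> std_flag i u -> col_lat i (chain_mx *m u).
Proof.
move=> le_id fu; rewrite chain_mxE; apply: (subgroup_sum (col_lat_subgroup i)) => k _.
by apply: col_lat_term => //; case: (std_flag_block k fu).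
Qed.

(** Only block [d.-1 - i] is new at step [i.+1]. The other terms already lie in [col_lat i.+1], so
    cancelling [X ^+ i] leaves a relation to which [Ffree] applies. *)
Lemma chain_mx_flag_inv i u : (i <= d)%N -> mx_in S u ->
  col_lat i (chain_mx *m u) -> std_flag i u.
Proof.
move=> + uS; elim: i => [|i IHi] id lu a; split; try exact: uS.
  by rewrite addn0 leqNgt ltn_ord.
have fu := IHi (ltnW id) (col_lat_le (leqnSn i) lu).
rewrite addnS leq_eqVlt => /orP [/eqP dE|]; last by rewrite ltnS; case: (fu a).
set k := tagnat.sig1 a in dE.
have ukE : u a 0 = submxcol u k (tagnat.sig2 a) 0 by rewrite mxE tagnat.sig2K.
have [ukS _] := std_flag_block k fu.
have dk : (d.-1 - k)%N = i by have /(congr1 predn) /= -> := dE; rewrite addKn.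
have [w wS wE] : col_lat i.+1 (X ^+ i *m (F *m submxcol u k)).
  have gl := col_lat_subgroup i.+1.
  move: lu; rewrite chain_mxE (bigD1 k) //= dk => lu.
  apply: (subgroupBl gl (y := - \sum_(j < d | j != k) X ^+ (d.-1 - j) *m (F *m submxcol u j))).
    by rewrite opprK.
  apply: (subgroupN gl); apply: (subgroup_sum gl) => j jk.
  have [ujS ujP] := std_flag_block j fu; apply: col_lat_term => //.
  rewrite addnS leq_eqVlt => /orP [/eqP dE'|]; last by rewrite ltnS.
  by case/eqP: jk; apply: val_inj; have [] := etrans (esym dE') dE; move/addIn.
rewrite ukE; apply: (Ffree ukS wS).
have := congr1 (mulmx (Xi ^+ i)) wE.
by rewrite !mulmxA exprSr -mulmxE !mulmxA XkK !mul1mx.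
Qed.

(** Successive approximation: a remainder in [col_lat i] is corrected by the block that carries
    [X ^+ i]. *)
Lemma chain_mx_span i v : (i <= d)%N -> mx_in S v ->
  exists2 u, mx_in S u & col_lat i (v - chain_mx *m u).
Proof.
move=> + vS; elim: i => [|i IHi] id.
  exists 0; first exact: (subgroup0 (gmS _ _)).
  by exists v => //; rewrite mulmx0 subr0 expr0 mul1mx.
have [u uS [v' v'S E]] := IHi (ltnW id).
have [t [w [tS wS v'E]]] := Fspan v'S.
have kd : (d.-1 - i < d)%N by rewrite (leq_ltn_trans (leq_subr _ _)) // ltn_predL (leq_trans _ id).
pose k := Ordinal kd.
pose y : 'cV[A]_(\sum_(k < d) c) := \mxcol_j (if j == k then t else 0).
exists (u + y).
  apply: (subgroupD (gmS _ _)) => // a b; rewrite mxE.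
  by case: eqP => _; [apply: tS | rewrite mxE; apply: (subgroup0 gS)].
exists w => //; rewrite mulmxDr opprD addrA E v'E.
have -> : chain_mx *m y = X ^+ i *m (F *m t).
  rewrite chain_mxE (bigD1 k) //= mxcolK eqxx subKn -1?ltnS ?(ltn_predK id) //.
  rewrite [X in _ + X]big1 ?addr0 // => j jk.
  by rewrite mxcolK (negPf jk) !mulmx0.
by rewrite mulmxDr addrC addKr exprSr -mulmxE mulmxA.
Qed.

(** [N] and [d c] are not known to agree, so the two sides are treated separately. At level [d] the
    error of approximation lies in [P], which gives a right inverse [H]. Then [chain_mx] kills
    [1 - H *m chain_mx], so this lies in [P], and [H *m chain_mx] is an invertible idempotent. *)
Lemma chain_mx_inverse : exists H : 'M[A]_(\sum_(k < d) c, N),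
  [/\ mx_in S H, chain_mx *m H = 1%:M & H *m chain_mx = 1%:M].
Proof.
have col1S a : mx_in S (col a (1%:M : 'M_N)).
  by move=> i j; rewrite mxE; apply: mx_in_1.
have colU a : exists u, mx_in S u /\ col_lat d (col a 1%:M - chain_mx *m u).
  by have [u] := chain_mx_span (leqnn d) (col1S a); exists u.
have [u uP] := fin_all_exists colU.
pose U := \matrix_(i, a) u a i 0.
have colUE a : col a U = u a by apply/matrixP => i j; rewrite !mxE ord1.
have US : mx_in S U by move=> i a; rewrite mxE; case: (uP a) => + _; apply.
have pP : mx_in P (1%:M - chain_mx *m U).
  move=> i a; case: (uP a) => _ /PX /(_ i 0).
  by rewrite !mxE (eq_bigr (fun j => chain_mx i j * U j a)) // => j _; rewrite !mxE.
have qP' n := mx_quasiregular (n := n) sS gP lP PS qP.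
have inv n := quasiregular_inv (mx_over_subring n sS) (gmP n n)
  (fun x y => mx_in_mull gP lP (x := x) (y := y)) (qP' n).
have [t tS [_ t1]] := inv N _ pP; rewrite subKr in t1.
have GH : chain_mx *m (U *m t) = 1%:M by rewrite mulmxA.
have HS : mx_in S (U *m t) by apply: S_mul.
set H := U *m t in GH HS; exists H; split=> //.
pose Q := 1%:M - H *m chain_mx.
have QP : mx_in P Q.
  have QS : mx_in S Q.
    apply: (subgroupB (gmS _ _)); first exact: mx_in_1.
    exact: (S_mul HS chain_mxS).
  move=> a b; have fQ : std_flag d (col b Q).
    apply: chain_mx_flag_inv => //; first by move=> i j; rewrite mxE; apply: QS.
    rewrite colE mulmxA mulmxBr mulmx1 mulmxA GH mul1mx subrr mul0mx.
    exact: (subgroup0 (col_lat_subgroup d)).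
  by case: (fQ a) => _; rewrite leq_addl mxE; apply.
have [s _ [s1 _]] := inv _ _ QP; rewrite subKr in s1.
have idem : H *m chain_mx *m (H *m chain_mx) = H *m chain_mx.
  by rewrite mulmxA -[H *m _ *m H]mulmxA GH mulmx1.
transitivity (s *m (H *m chain_mx) *m (H *m chain_mx)); last by rewrite -mulmxA idem.
by rewrite (s1 : s *m (H *m chain_mx) = 1%:M) mul1mx.
Qed.

Lemma chain_mx_conj H (Z : 'M[A]_N) :
  mx_in S H -> chain_mx *m H = 1%:M -> H *m chain_mx = 1%:M ->
  (forall i, (i < d)%N -> forall v, col_lat i v -> col_lat i (Z *m v)) <->
  forall a b : 'I_(\sum_(k < d) c), S ((H *m Z *m chain_mx) a b) /\
    ((tagnat.sig1 b < tagnat.sig1 a)%N -> P ((H *m Z *m chain_mx) a b)).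
Proof.
move=> HS GH HG; set Y := H *m Z *m chain_mx.
have GY : chain_mx *m Y = Z *m chain_mx by rewrite /Y !mulmxA GH mul1mx.
split=> [stab a b|YP i id v lv].
  (* The deepest flag that the unit column [b] is sure to lie in; it forces into [P] exactly the
     entries below the diagonal block of [b]. *)
  pose i := (d.-1 - tagnat.sig1 b)%N.
  have bd : (tagnat.sig1 b < d)%N := ltn_ord _.
  have ibE : (tagnat.sig1 b + i).+1 = d.
    by rewrite /i subnKC ?(ltn_predK bd) // -ltnS (ltn_predK bd).
  have id : (i < d)%N by rewrite -ibE ltnS leq_addl.
  have f1 : std_flag i (col b 1%:M).
    move=> a'; rewrite !mxE; split; first by have := mx_in_1 sS (a' : 'I__) b; rewrite mxE.
    case: eqP => [->|_ _]; last exact: (subgroup0 gP).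
    by rewrite -{1}ibE ltnn.
  have lY : col_lat i (chain_mx *m col b Y).
    rewrite colE mulmxA GY -mulmxA; apply: stab => //.
    have := chain_mx_flag (ltnW id) f1.
    by rewrite colE mul1mx.
  have fY : std_flag i (col b Y).
    apply: (chain_mx_flag_inv (ltnW id) _ lY).
    have := S_mul HS (col_lat_S lY); by rewrite mulmxA HG mul1mx.
  case: (fY a); rewrite mxE => SY PY; split=> // ba; apply: PY.
  by rewrite -{1}ibE -addSn leq_add2r.
pose u := H *m v.
have uE : chain_mx *m u = v by rewrite mulmxA GH mul1mx.
have fu : std_flag i u.
  apply: chain_mx_flag_inv; [exact: ltnW | | by rewrite uE].
  exact: (S_mul HS (col_lat_S lv)).
rewrite -uE mulmxA -GY -mulmxA; apply: chain_mx_flag; first exact: ltnW.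
move=> a; rewrite mxE; split=> [|da].
  by apply: subgroup_sum => // b _; apply: SM; [case: (YP a b) | case: (fu b)].
apply: subgroup_sum => // b _; have [SY PY] := YP a b; have [Su Pu] := fu b.
case: (ltnP (tagnat.sig1 b) (tagnat.sig1 a)) => ba; first by apply: rP => //; apply: PY.
by apply: lP => //; apply: Pu; rewrite (leq_trans da) // leq_add2r.
Qed.

End Flag.

(** * Block matrices *)

Section Blocks.
Variable A : pzRingType.

Lemma submxblock_mul a b c (p : 'I_a -> nat) (q : 'I_b -> nat) (s : 'I_c -> nat)
    (Y : 'M[A]_(\sum_i p i, \sum_i q i)) (Z : 'M[A]_(\sum_i q i, \sum_i s i)) i k :
  submxblock (Y *m Z) i k = \sum_j submxblock Y i j *m submxblock Z j k.
Proof. by rewrite -{1}[Y]submxblockK -{1}[Z]submxblockK mul_mxblock mxblockK. Qed.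

Definition flatten_mx b n (Y : 'M['M[A]_n]_b) : 'M[A]_(\sum_(i < b) n) :=
  \mxblock_(i, j) Y i j.

(* The inverse flattening with the two levels of indices exchanged. *)
Definition swap_blocks c d (Z : 'M[A]_(\sum_(k < d) c)) : 'M['M[A]_d]_c :=
  \matrix_(j, j') \matrix_(k, l) submxblock Z k l j j'.

Lemma flatten_mxM b n (Y Z : 'M['M[A]_n]_b) :
  flatten_mx (Y * Z) = flatten_mx Y *m flatten_mx Z.
Proof. by rewrite mul_mxblock; apply: eq_mxblock => i j; rewrite mxE. Qed.

Lemma flatten_mxD b n (Y Z : 'M['M[A]_n]_b) :
  flatten_mx (Y + Z) = flatten_mx Y + flatten_mx Z.
Proof. by rewrite -mxblockD; apply: eq_mxblock => i j; rewrite mxE. Qed.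

Lemma flatten_mx_inj b n : injective (@flatten_mx b n).
Proof. by move=> Y Z /eq_mxblockP E; apply/matrixP => i j. Qed.

Lemma flatten_mx_surj b n (Z : 'M[A]_(\sum_(i < b) n)) : exists Y, flatten_mx Y = Z.
Proof.
exists (\matrix_(i, j) submxblock Z i j); rewrite -[RHS]submxblockK.
by apply: eq_mxblock => i j; rewrite mxE.
Qed.

Lemma swap_blocksM c d (Y Z : 'M[A]_(\sum_(k < d) c)) :
  swap_blocks (Y *m Z) = swap_blocks Y * swap_blocks Z.
Proof.
apply/matrixP => j j'; rewrite !mxE; apply/matrixP => k l.
rewrite mxE submxblock_mul !summxE.
under eq_bigr => i _ do rewrite mxE.
rewrite exchange_big; apply: eq_bigr => i _; rewrite mxE.
by apply: eq_bigr => m _; rewrite !mxE.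
Qed.

Lemma swap_blocksD c d (Y Z : 'M[A]_(\sum_(k < d) c)) :
  swap_blocks (Y + Z) = swap_blocks Y + swap_blocks Z.
Proof. by apply/matrixP => j j'; apply/matrixP => k l; rewrite !mxE. Qed.

Lemma swap_blocks_inj c d : injective (@swap_blocks c d).
Proof.
move=> Y Z E; apply/mxblockP => k l; apply/matrixP => j j'.
by have /matrixP /(_ j j') /matrixP /(_ k l) := E; rewrite ![in LHS]mxE ![in RHS]mxE !mxE.
Qed.

Lemma swap_blocks_surj c d (Y : 'M['M[A]_d]_c) :
  exists Z : 'M[A]_(\sum_(k < d) c), swap_blocks Z = Y.
Proof.
exists (\mxblock_(k, l) \matrix_(j, j') Y j j' k l).
by apply/matrixP => j j'; apply/matrixP => k l; rewrite 2!mxE mxblockK mxE.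
Qed.

Lemma swap_blocks_entry c d (Z : 'M[A]_(\sum_(k < d) c)) (a b : 'I_(\sum_(k < d) c)) :
  swap_blocks Z (tagnat.sig2 a) (tagnat.sig2 b) (tagnat.sig1 a) (tagnat.sig1 b) = Z a b.
Proof. by rewrite !mxE !tagnat.sig2K. Qed.

Lemma conj_ring_iso b n c d (L1 : 'M['M[A]_n]_b -> Prop) (L2 : 'M['M[A]_d]_c -> Prop)
    (G : 'M[A]_(\sum_(i < b) n, \sum_(k < d) c)) (H : 'M[A]_(\sum_(k < d) c, \sum_(i < b) n)) :
  G *m H = 1%:M -> H *m G = 1%:M ->
  (forall Y, L1 Y <-> L2 (swap_blocks (H *m flatten_mx Y *m G))) -> ring_iso L1 L2.
Proof.
move=> GH HG L12; pose f Y := swap_blocks (H *m flatten_mx Y *m G).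
have fM Y Z : f (Y * Z) = f Y * f Z.
  rewrite /f -swap_blocksM flatten_mxM; congr swap_blocks; rewrite !mulmxA.
  by rewrite -[_ *m G *m H]mulmxA GH mulmx1.
have f_surj Y : exists Z, f Z = Y.
  have [Z <-] := swap_blocks_surj Y; have [W WE] := flatten_mx_surj (G *m Z *m H).
  by exists W; rewrite /f WE !mulmxA HG mul1mx -mulmxA HG mulmx1.
exists f; split; [by move=> Y /L12 | split; [|split; [|split; [|split]]]].
- by move=> Y L2Y; have [Z ZE] := f_surj Y; exists Z; split=> //; apply/L12; rewrite -/(f Z) ZE.
- move=> Y Z _ _ /swap_blocks_inj E; apply: flatten_mx_inj.
  have := congr1 (fun M => G *m M *m H) E.
  by rewrite !mulmxA GH !mul1mx -!mulmxA GH !mulmx1.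
- have [Z ZE] := f_surj 1.
  by rewrite -[f 1]mulr1 -ZE -fM mul1r.
- by move=> Y Z _ _; rewrite /f flatten_mxD mulmxDr mulmxDl swap_blocksD.
- by move=> Y Z _ _; apply: fM.
Qed.

Variables (S : A -> Prop) (n b : nat) (x : 'M[A]_n).
Hypothesis sS : subring_of S.

Let X : 'M[A]_(\sum_(i < b) n) := \mxdiag_(i < b) x.

Lemma expr_mxdiag_mxcol k (u : 'I_b -> 'cV[A]_n) :
  X ^+ k *m (\mxcol_i u i) = \mxcol_i (x ^+ k *m u i).
Proof.
elim: k u => [|k IHk] u.
  by rewrite expr0 mul1mx; apply: eq_mxcol => i; rewrite expr0 mul1mx.
rewrite exprSr -mulmxE -mulmxA mul_mxdiag_mxcol IHk; apply: eq_mxcol => i.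
by rewrite exprSr -mulmxE mulmxA.
Qed.

Lemma col_lat_mxdiag k (v : 'I_b -> 'cV[A]_n) :
  col_lat S X k (\mxcol_i v i) <-> forall i, col_lat S x k (v i).
Proof.
split=> [[u uS vE] i|vP].
  move: uS vE; rewrite -[u]submxcolK => /mx_in_mxcol uS.
  by rewrite expr_mxdiag_mxcol => /eq_mxcolP vE; exists (submxcol u i).
have [u uP] := fin_all_exists (fun i => let: ex_intro2 u uS uE := vP i in
  ex_intro (fun u => mx_in S u /\ v i = x ^+ k *m u) u (conj uS uE)).
exists (\mxcol_i u i); first by apply/mx_in_mxcol => i; case: (uP i).
by rewrite expr_mxdiag_mxcol; apply: eq_mxcol => i; case: (uP i).
Qed.

Lemma stable_flatten (L : 'M[A]_n -> Prop) d :
  (forall a, L a <-> forall i, (i < d)%N -> forall v, col_lat S x i v -> col_lat S x i (a *m v)) ->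
  forall Y : 'M_b, mx_over L Y <-> forall i, (i < d)%N ->
    forall v, col_lat S X i v -> col_lat S X i (flatten_mx Y *m v).
Proof.
move=> LP Y; split=> [LY i id v|YP a a'].
  rewrite -[v]submxcolK => /col_lat_mxdiag vP.
  rewrite mul_mxblock_mxrow; apply/col_lat_mxdiag => j.
  apply: (subgroup_sum (col_lat_subgroup x sS i)) => k _.
  by have /LP := LY j k; apply.
apply/LP => i id v lv; pose w k : 'cV[A]_n := if k == a' then v else 0.
have /(YP i id) : col_lat S X i (\mxcol_k w k).
  apply/col_lat_mxdiag => k; rewrite /w; case: eqP => // _.
  exact: (subgroup0 (col_lat_subgroup x sS i)).
rewrite mul_mxblock_mxrow => /col_lat_mxdiag /(_ a).
rewrite (bigD1 a') //= {1}/w eqxx big1 ?addr0 // => k ka.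
by rewrite /w (negPf ka) mulmx0.
Qed.

End Blocks.

(** * From matrix lattices to column lattices *)

Section Columns.
Variables (A : pzRingType) (S : A -> Prop) (n : nat) (x : 'M[A]_n).
Hypothesis n0 : (0 < n)%N.

Lemma lat_col i (V : 'M[A]_n) :
  lat (@mx_in A n n S) x i V <-> forall j, col_lat S x i (col j V).
Proof.
split=> [[g gS ->] j|VP].
  by exists (col j g); [move=> k l; rewrite mxE | rewrite !colE mulmxA].
have [u uP] := fin_all_exists (fun j => let: ex_intro2 u uS uE := VP j in
  ex_intro (fun u => mx_in S u /\ col j V = x ^+ i *m u) u (conj uS uE)).
exists (\matrix_(k, j) u j k 0); first by move=> k j; rewrite mxE; case: (uP j) => + _; apply.
apply/matrixP => k j; have [_ /matrixP /(_ k 0)] := uP j; rewrite !mxE => ->.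
by apply: eq_bigr => l _; rewrite mxE.
Qed.

Let repeat_col (v : 'cV[A]_n) : 'M[A]_n := \matrix_(i, _) v i 0.

Let col_repeat v j : col j (repeat_col v) = v.
Proof. by apply/matrixP => i k; rewrite !mxE ord1. Qed.

Lemma lat_stable_col i (a : 'M[A]_n) :
  (forall V, lat (@mx_in A n n S) x i V -> lat (@mx_in A n n S) x i (a * V)) <->
  (forall v, col_lat S x i v -> col_lat S x i (a *m v)).
Proof.
split=> [aP v lv|aP V /lat_col VP].
  have /aP/lat_col/(_ (Ordinal n0)) : lat (@mx_in A n n S) x i (repeat_col v).
    by apply/lat_col => j; rewrite col_repeat.
  by rewrite colE -mulmxE -mulmxA -colE col_repeat.
by apply/lat_col => j; rewrite colE -mulmxE -mulmxA -colE; apply: aP.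
Qed.

Lemma mx_in_lat_col (P : A -> Prop) d :
  (forall V, mx_in P V <-> lat (@mx_in A n n S) x d V) ->
  forall v : 'cV_n, mx_in P v <-> col_lat S x d v.
Proof.
move=> PV v; split=> [vP|lv].
  have /PV/lat_col/(_ (Ordinal n0)) : mx_in P (repeat_col v) by move=> i j; rewrite mxE.
  by rewrite col_repeat.
have /PV vP : lat (@mx_in A n n S) x d (repeat_col v).
  by apply/lat_col => j; rewrite col_repeat.
by move=> i j; rewrite ord1; have := vP i (Ordinal n0); rewrite mxE.
Qed.

End Columns.

(** * Assembling the isomorphism *)

Lemma chain_order_iso (A : pzRingType) (S P : A -> Prop) (D : unitRingType) (r : nat)
    (phi : A -> 'M[D]_r) (n d : nat) (x xi : 'M[A]_n) (L : 'M[A]_n -> Prop) :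
  subring_of S -> (forall y, P y -> S y) -> left_quasiregular S P ->
  (forall t : D, t != 0 -> t \is a GRing.unit) ->
  (forall y z, S y -> S z -> phi (y + z) = phi y + phi z) ->
  (forall y z, S y -> S z -> phi (y * z) = phi y * phi z) ->
  phi 1 = 1 -> (forall z, exists y, S y /\ phi y = z) ->
  (forall y, S y -> (phi y = 0 <-> P y)) -> ~ P 1 ->
  mx_in S x -> xi * x = 1 -> (0 < n)%N -> (0 < d)%N ->
  ~ lat (@mx_in A n n S) x 1 1 ->
  (forall v, mx_in P v <-> lat (@mx_in A n n S) x d v) ->
  (forall a, L a <-> forall i, (i < d)%N -> forall v,
     lat (@mx_in A n n S) x i v -> lat (@mx_in A n n S) x i (a * v)) ->
  exists b c : nat, [/\ (b %| r)%N, (0 < c)%N &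
    ring_iso (@mx_over _ b L) (@mx_over _ c (fun Y : 'M[A]_d =>
      forall i j : 'I_d, ((i <= j)%N -> S (Y i j)) /\ ((j < i)%N -> P (Y i j))))].
Proof.
move=> sS PS qP divD phiD phiM phi1 phi_surj phiP nP1 xS xix n0 d0 x1 Px Lx.
have gP := residue_subgroup sS phiD phiP PS.
have lP := residue_lstable sS phiM phiP PS.
have rP := residue_rstable sS phiM phiP PS.
have [S1 _ SM] := sS.
have r0 : (0 < r)%N.
  (* If [r] were zero, [phi 1] would be zero and [1] would lie in [P]. *)
  rewrite lt0n; apply/eqP => r0; apply: nP1; apply/phiP => //.
  by apply/matrixP => i; have := ltn_ord i; rewrite {2}r0.
pose o := Ordinal r0.
have [E' E'P] := fin_all_exists (fun uv : 'I_r * 'I_r => phi_surj (delta_mx uv.1 uv.2)).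
pose E u v := E' (u, v).
have SE u v : S (E u v) by case: (E'P (u, v)).
have phiE u v : phi (E u v) = delta_mx u v by case: (E'P (u, v)).
have Pcol := mx_in_lat_col n0 Px.
have col1 N (X : 'M[A]_N) : mx_in S X ->
    (forall v : 'cV_N, mx_in P v <-> col_lat S X d v) ->
    forall v : 'cV_N, mx_in P v -> exists2 u, mx_in S u & v = X *m u.
  by move=> XS PX v /PX /(col_lat_le sS XS d0) [u uS ->]; exists u; rewrite ?expr1.
have [m [W [WS Wsp Wfree]]] :=
  residue_basis_exists sS divD phiD phiM phi1 phi_surj phiP PS o SE phiE (col1 _ _ xS Pcol).
have m0 : (0 < m)%N.
  (* If [W] had no columns, every integral column would be a multiple of [x], against [x1]. *)
  rewrite lt0n; apply/eqP => m0; apply: x1; apply/lat_col => j.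
  have [|t [u [_ uS ->]]] := Wsp (col j 1%:M).
    by move=> i l; rewrite mxE; apply: mx_in_1.
  exists u; rewrite // expr1 -[RHS]add0r; congr (_ + _).
  apply/matrixP => i l; rewrite !mxE big1 // => k.
  by have := ltn_ord k; rewrite {2}m0.
have g0 : (0 < gcdn m r)%N by rewrite gcdn_gt0 m0.
pose b := (r %/ gcdn m r)%N; pose c := (m %/ gcdn m r)%N.
exists b, c; split.
- by rewrite -[X in (_ %| X)%N](divnK (dvdn_gcdr m r)) dvdn_mulr.
- by rewrite divn_gt0 // dvdn_leq ?dvdn_gcdl.
pose X : 'M[A]_(\sum_(i < b) n) := \mxdiag_(i < b) x.
pose Xi : 'M[A]_(\sum_(i < b) n) := \mxdiag_(i < b) xi.
have XiX : Xi * X = 1.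
  have XiXv (v : 'cV_(\sum_(i < b) n)) : Xi *m (X *m v) = v.
    rewrite -[v]submxcolK !mul_mxdiag_mxcol; apply: eq_mxcol => i.
    by rewrite mulmxA mulmxE xix mul1mx.
  apply/matrixP => i j; have := XiXv (col j 1%:M).
  rewrite colE mul1mx mulmxA -colE => /matrixP /(_ i 0).
  by rewrite [in LHS]mxE mulmxE => ->; rewrite !mxE eqxx andbT.
have XS : mx_in S X.
  move=> i j; have : mx_in S (X *m col j 1%:M).
    rewrite -[col j _]submxcolK mul_mxdiag_mxcol; apply/mx_in_mxcol => k.
    apply: (mx_in_mull (subring_subgroup sS) SM) => //.
    by move=> a a'; rewrite !mxE; have := mx_in_1 sS (tagnat.Rank k a) j; rewrite mxE.
  by move/(_ i 0); rewrite colE mulmxA mulmx1 -colE mxE.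
have PX (v : 'cV_(\sum_(i < b) n)) : mx_in P v <-> col_lat S X d v.
  rewrite -[v]submxcolK; split=> [/mx_in_mxcol vP|/col_lat_mxdiag vP].
    by apply/col_lat_mxdiag => i; apply/Pcol.
  by apply/mx_in_mxcol => i; apply/Pcol.
have [W' [W'S W'sp W'free]] := residue_copies sS b WS Wsp Wfree.
have EM : (\sum_(i < b) m = \sum_(j < c) r)%N.
  by rewrite !sum_nat_const !card_ord mulnC -[RHS]mulnC muln_divCA_gcd.
have [F [FS Fspan Ffree]] :=
  residue_regroup sS phiD phiM phiP PS SE phiE EM (col1 _ _ XS PX) W'S W'sp W'free.
have [H [HS GH HG]] := chain_mx_inverse sS PS gP lP qP XS XiX FS PX Fspan Ffree.
apply: (conj_ring_iso GH HG) => Y.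
have Lcol a : L a <-> forall i, (i < d)%N -> forall v,
    col_lat S x i v -> col_lat S x i (a *m v).
  split=> [/Lx aP i id|aP]; first exact/lat_stable_col/aP.
  by apply/Lx => i id; apply/lat_stable_col/aP.
rewrite (stable_flatten sS Lcol) (chain_mx_conj sS gP lP rP XS XiX FS PX Ffree _ HS GH HG).
set Z := H *m _ *m _; split=> [ZP j j' k l|ZP a a'].
  rewrite 2!mxE [submxblock _ _ _ _ _]mxE.
  have [SZ PZ] := ZP (tagnat.Rank k j) (tagnat.Rank l j').
  by split=> // lk; apply: PZ; rewrite !tagnat.Rank1K.
rewrite -swap_blocks_entry.
have [SZ PZ] := ZP (tagnat.sig2 a) (tagnat.sig2 a') (tagnat.sig1 a) (tagnat.sig1 a').
by split=> //; case: (leqP (tagnat.sig1 a) (tagnat.sig1 a')) => [/SZ|/PZ/PS].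
Qed.

(** Bridges the scalings [*:%R] and [mx_scale] of the statement and multiplication by the central
    [io k]. *)
Lemma is_order_ext (K : fieldType) (B : pzRingType) (sc sc' : K -> B -> B)
    (R : K -> Prop) (L : B -> Prop) :
  (forall k y, sc k y = sc' k y) -> is_order sc R L -> is_order sc' R L.
Proof.
move=> E [sL LR [s [sL1 sP]] LK]; split=> // [k y Rk Ly||y].
- by rewrite -E; apply: LR.
- exists s; split=> // y /sP [c [cR cs ->]]; exists c; split=> //.
  by apply: eq_bigr => i _; rewrite E.
- by have [k [Rk k0 Lky]] := LK y; exists k; split=> //; rewrite -E.
Qed.

Theorem theorem6p5 (K : fieldType) (R : K -> Prop) (A : falgType K)
    (Delta : A -> Prop) (r n d : nat) (Lambda : 'M[A]_n -> Prop) :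
  is_DVR R ->
  (* A = K Delta is a K-central division algebra *)
  (forall x : A, x != 0 -> x \is a GRing.unit) ->
  (forall x : A, (forall y, x * y = y * x) -> exists k : K, x = k%:A) ->
  (* Delta is a maximal R-order in A *)
  max_order R Delta ->
  (* Delta / rad Delta ~= M_r(D) for a division ring D *)
  (exists (D : unitRingType) (phi : A -> 'M[D]_r),
        (forall x : D, x != 0 -> x \is a GRing.unit)
     /\ (forall x y, Delta x -> Delta y -> phi (x + y) = phi x + phi y)
     /\ (forall x y, Delta x -> Delta y -> phi (x * y) = phi x * phi y)
     /\ phi 1 = 1
     /\ (forall z, exists x, Delta x /\ phi x = z)
     /\ (forall x, Delta x -> (phi x = 0 <-> jrad Delta x))) ->
  (0 < n)%N ->
  (* Lambda is a normal hereditary R-order in M_n(A), contained in M_n(Delta) *)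
  (forall M, Lambda M -> mx_over Delta M) ->
  is_order (@mx_scale K A n) R Lambda ->
  normal_order Lambda ->
  hereditary Lambda ->
  num_simple_classes Lambda d ->
  exists b c : nat, [/\ (b %| r)%N, (0 < c)%N &
    ring_iso (@mx_over _ b Lambda) (@mx_over _ c (@Delta_d K A Delta d))].
Proof.
move=> [sR _ [p pR]] _ _ [oD0 _] [D [phi [divD [phiD [phiM [phi1 [phi_surj phiP]]]]]]].
move=> n0 LamD oL0 [_ [x [_ [Jx xreg]]]] [herL _] dL.
pose ioA : {rmorphism K -> A} := in_alg A.
pose io : {rmorphism K -> 'M[A]_n} := @scalar_mx A n \o in_alg A.
have ioAC k y : ioA k * y = y * ioA k by rewrite /= mulr_algl mulr_algr.
have ioZ k (M : 'M[A]_n) : io k * M = mx_scale k M.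
  by apply/matrixP => i j; rewrite /= -mulmxE mul_scalar_mx !mxE mulr_algl.
have ioC k (M : 'M[A]_n) : io k * M = M * io k.
  apply/matrixP => i j; rewrite ioZ mxE -mulmxE mxE (bigD1 j) //= big1 => [|l lj].
    by rewrite mxE eqxx mulr1n addr0 mulr_algr.
  by rewrite mxE (negPf lj) mulr0n mulr0.
have oD : central_order R ioA Delta.
  by apply: is_order_ext oD0 => k y; rewrite /= mulr_algl.
have oL : central_order R io Lambda.
  by apply: is_order_ext oL0 => k M; rewrite ioZ.
have sD : subring_of Delta by case: oD.
have [gJ lJ] := jrad_ideal oD.
have JD y : jrad Delta y -> Delta y by case.
have rJ := residue_rstable sD phiM phiP JD.
have qJ := jrad_quasiregular sR pR ioAC oD.
have nJ1 : ~ jrad Delta 1.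
  by case/qJ=> s _; rewrite subrr mulr0 => /esym/eqP; rewrite oner_eq0.
have [xi [xxi xix]] := regular_invertible ioC oL xreg.
(* Each map sending [y] to [y *: delta_mx i j] carries [Delta] into [Lambda] after a power of [p];
   the sum of the exponents serves all entries. *)
have absG : exists t, forall g : 'M[A]_n, mx_over Delta g -> Lambda (io (p ^+ t) * g).
  have [_ _ [s [_ sP]] _] := oD0.
  have entry (ij : 'I_n * 'I_n) : exists t, forall u y, (t <= u)%N -> Delta y ->
      Lambda (io (p ^+ u) * (y *: delta_mx ij.1 ij.2)).
    apply: (order_absorbs sR pR (sc := *:%R)) oL _; last by exists s.
    - by move=> y z; rewrite scalerDl.
    - by rewrite scale0r.
    - move=> k y; rewrite ioZ; apply/matrixP => i j; rewrite !mxE.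
      by rewrite scalerAl.
  have [t tP] := fin_all_exists entry; exists (\sum_ij t ij)%N => g gD.
  have gL := subring_subgroup (let: And4 sL _ _ _ := oL in sL).
  rewrite [g]matrix_sum_delta mulr_sumr; apply: (subgroup_sum gL) => i _.
  rewrite mulr_sumr; apply: (subgroup_sum gL) => j _; apply: (tP (i, j)) => //.
  by rewrite (bigD1 (i, j)) //= leq_addr.
have Jp : mx_over (jrad Delta) (io p).
  move=> i j; rewrite mxE; case: eqP => _; last exact: (subgroup0 gJ).
  exact: (jrad_pi sR pR ioAC oD).
have one_n0 : (1 : 'M[A]_n) <> 0.
  move=> /matrixP /(_ (Ordinal n0) (Ordinal n0)); rewrite !mxE eqxx => /eqP.
  by rewrite oner_eq0.
have simpleG := matrix_ideal_unit sD divD phiD phiM phi1 phi_surj phiP JD (n := n).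
have [d0 x1 Px Lx] := chain_structure sR pR ioC oL (mx_over_subring n sD) LamD absG
  (fun y yJ i j => JD _ (yJ i j)) (mx_in_subgroup gJ n n)
  (fun s y => mx_in_mull gJ lJ (x := s) (y := y))
  (fun s y Ds Jy => mx_in_mulr gJ rJ Jy Ds)
  (mx_quasiregular sD gJ lJ JD qJ)
  (fun I gI lI rI a => simpleG I a gI lI rI)
  Jp xxi xix Jx herL one_n0 dL.
have xD : mx_over Delta x.
  suff [] : jrad Lambda x by move/LamD.
  by apply/Jx; exists 1; split; [case: oL => -[] | rewrite mulr1].
exact: (chain_order_iso sD JD qJ divD phiD phiM phi1 phi_surj phiP nJ1 xD xix n0 d0 x1 Px Lx).
Qed.
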